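(* Let $\mathcal{M} \models \mathrm{KP}^\mathcal{P} + \Sigma_1^\mathcal{P}\text{-Separation}$ and $\mathcal{N} \models \mathrm{KP}^\mathcal{P}$ be countable and non-standard, and let $\mathcal{S}$ be a common rank-cut of $\mathcal{M}$ and $\mathcal{N}$. Let $m_0 \in \mathcal{M}$, $n_0 \in \mathcal{N}$ and $\beta \in \mathrm{Ord}^\mathcal{N}$. Then the following are equivalent: (a) There is a rank-initial embedding $i : \mathcal{M} \rightarrow \mathcal{N}$, fixing $\mathcal{S}$ pointwise, such that $i(m_0) = n_0$ and $i(\mathcal{M}) \subseteq \mathcal{N}_\beta$. (b) $\mathrm{SSy}_\mathcal{S}(\mathcal{M}) = \mathrm{SSy}_\mathcal{S}(\mathcal{N})$, and for all $s \in \mathcal{S}$ and all $\Delta_0^\mathcal{P}$-formulae $\delta(x,y,z)$: if $\mathcal{M} \models \exists x\, \delta(x, m_0, s)$ then $\mathcal{N} \models \exists x \in V_\beta\, \delta(x, n_0, s)$. (c) There is a map $g \mapsto i_g$ from sequences $g : \omega \rightarrow 2$ to embeddings $i_g : \mathcal{M} \rightarrow \mathcal{N}$, each satisfying the requirements on $i$ in (a), such that for any $g, g' : \omega \to 2$ with $g <^{\mathrm{lex}} g'$ we have $i_g <^{\mathrm{rank}} i_{g'}$. (d) There is a topless embedding $i : \mathcal{M} \rightarrow \mathcal{N}$ satisfying the requirements on $i$ in (a).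
   Context: $\mathcal{L}^0$ is the first-order language of set theory, with the binary symbol $\in$. Takahashi hierarchy: $\Delta_0^\mathcal{P}=\Sigma_0^\mathcal{P}=\Pi_0^\mathcal{P}$ is the set of $\mathcal{L}^0$-formulae all of whose quantifiers are of the forms $\exists x\in y$, $\forall x\in y$, $\exists x\subseteq y$, $\forall x\subseteq y$; $\Sigma_{n+1}^\mathcal{P}$ consists of formulae $\exists x\,\phi$ with $\phi\in\Pi_n^\mathcal{P}$, and $\Pi_{n+1}^\mathcal{P}$ of formulae $\forall x\,\phi$ with $\phi\in\Sigma_n^\mathcal{P}$ (all up to provable equivalence in $\mathrm{KP}^\mathcal{P}$). $\mathrm{KP}^\mathcal{P}$ has the axioms Extensionality, Pair, Union, Powerset, Infinity, and the schemata (with parameters) $\Delta_0^\mathcal{P}$-Separation, $\Delta_0^\mathcal{P}$-Collection ($\forall x(\forall u\in x\,\exists v\,\phi(u,v)\to\exists y\,\forall u\in x\,\exists v\in y\,\phi(u,v))$), and $\Pi_1^\mathcal{P}$-Foundation ($\exists x\,\phi(x)\to\exists y(\phi(y)\wedge\forall v\in y\,\neg\phi(v))$). It proves that $\alpha\mapsto V_\alpha$ is total on the ordinals and that every set has a rank. $\Gamma$-Separation is the Separation schema for formulae in $\Gamma$. A model is non-standard if its interpretation of $\in$ is not well-founded. $\mathrm{Ord}^\mathcal{N}$ is the class of ordinals of $\mathcal{N}$, and $\mathcal{N}_\beta=\{n\in\mathcal{N}\mid\mathcal{N}\models\mathrm{rank}(n)<\beta\}$. An embedding $i:\mathcal{M}\to\mathcal{N}$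 is an injection with $\mathcal{M}\models x\in y\Leftrightarrow\mathcal{N}\models i(x)\in i(y)$. It is rank-initial if whenever $m\in\mathcal{M}$, $n\in\mathcal{N}$ and $\mathcal{N}\models\mathrm{rank}(n)\le\mathrm{rank}(i(m))$, then $n\in i(\mathcal{M})$. It is bounded if $i(\mathcal{M})\subseteq\mathcal{N}_\alpha$ for some $\alpha\in\mathrm{Ord}^\mathcal{N}$; it is topless if it is bounded and for every $\beta\in\mathrm{Ord}^\mathcal{N}\setminus i(\mathcal{M})$ there is $\beta'\in\mathrm{Ord}^\mathcal{N}\setminus i(\mathcal{M})$ with $\beta'<^\mathcal{N}\beta$. A rank-cut is a topless rank-initial embedding. These notions apply to a substructure $\mathcal{S}$ via its inclusion map (so a common rank-cut $\mathcal{S}$ of $\mathcal{M}$ and $\mathcal{N}$ is a common substructure that is rank-initial and topless in both). $\mathrm{SSy}_\mathcal{S}(\mathcal{M})$ is the structure $(\mathcal{S},\mathrm{Cod}_\mathcal{S}(\mathcal{M}))$, where $\mathrm{Cod}_\mathcal{S}(\mathcal{M})$ is the set of subsets of $\mathcal{S}$ of the form $\{x\in\mathcal{S}\mid\mathcal{M}\models x\in c\}$ with $c\in\mathcal{M}$. For rank-initial embeddings $i,j:\mathcal{M}\to\mathcal{N}$, $i<^{\mathrm{rank}}j$ means that the substructure of $\mathcal{N}$ on $i(\mathcal{M})$ is a proper rank-initial substructure of the substructure of $\mathcal{N}$ on $j(\mathcal{M})$. $<^{\mathrm{lex}}$ is the lexicographic order on sequences $\omega\to2$. *)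

(* Defs.v *)
From mathcomp Require Import all_boot.
From mathcomp Require Import boolp classical_sets functions cardinality.

Set Implicit Arguments.
Unset Strict Implicit.
Unset Printing Implicit Defensive.

Local Open Scope classical_set_scope.

Record structure := Structure {
  dom :> Type;
  elem : dom -> dom -> Prop }.

Notation "x '\E' y" := (elem x y) (at level 70, no associativity).

(** ** The language of set theory *)

(* De Bruijn indices: variable 0 is the one bound by the nearest quantifier. *)
Inductive formula : Type :=
| Fmem of nat & nat
| Feq of nat & nat
| Fneg of formula
| Fand of formula & formula
| Fex of formula.

Definition Fimp (p q : formula) := Fneg (Fand p (Fneg q)).
Definition Fall (p : formula) := Fneg (Fex (Fneg p)).
Definition Fsub (x y : nat) := Fall (Fimp (Fmem 0 x.+1) (Fmem 0 y.+1)).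

(* Bounded quantifiers: [y] is an index in the outer context, while [p] lives
   under the binder; the shift [y.+1] keeps the bound variable out of its own
   bound. *)
Definition Fex_in (y : nat) (p : formula) := Fex (Fand (Fmem 0 y.+1) p).
Definition Fall_in (y : nat) (p : formula) := Fall (Fimp (Fmem 0 y.+1) p).
Definition Fex_sub (y : nat) (p : formula) := Fex (Fand (Fsub 0 y.+1) p).
Definition Fall_sub (y : nat) (p : formula) := Fall (Fimp (Fsub 0 y.+1) p).

(* All free variables of [p] are among 0, ..., n-1. *)
Fixpoint free_below (n : nat) (p : formula) : bool :=
  match p with
  | Fmem x y | Feq x y => (x < n) && (y < n)
  | Fneg p => free_below n p
  | Fand p q => free_below n p && free_below n q
  | Fex p => free_below n.+1 p
  end.

Definition scons (T : Type) (x : T) (r : nat -> T) : nat -> T :=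
  fun k => if k is k'.+1 then r k' else x.

Fixpoint sat (M : structure) (r : nat -> M) (p : formula) : Prop :=
  match p with
  | Fmem x y => r x \E r y
  | Feq x y => r x = r y
  | Fneg p => ~ sat r p
  | Fand p q => sat r p /\ sat r q
  | Fex p => exists x : M, sat (scons x r) p
  end.

(** ** The Takahashi hierarchy *)

Inductive Delta0P : formula -> Prop :=
| Delta0P_mem x y : Delta0P (Fmem x y)
| Delta0P_eq x y : Delta0P (Feq x y)
| Delta0P_neg p : Delta0P p -> Delta0P (Fneg p)
| Delta0P_and p q : Delta0P p -> Delta0P q -> Delta0P (Fand p q)
| Delta0P_ex_in y p : Delta0P p -> Delta0P (Fex_in y p)
| Delta0P_all_in y p : Delta0P p -> Delta0P (Fall_in y p)
| Delta0P_ex_sub y p : Delta0P p -> Delta0P (Fex_sub y p)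
| Delta0P_all_sub y p : Delta0P p -> Delta0P (Fall_sub y p).

(* The classes are taken syntactically. Closing them under provable equivalence
   in KP^P changes neither KP^P together with Sigma_1^P-Separation nor any
   statement about the truth of such formulae in models of KP^P. *)
Fixpoint SigmaP (n : nat) (p : formula) : Prop :=
  if n is m.+1 then exists q, PiP m q /\ p = Fex q else Delta0P p
with PiP (n : nat) (p : formula) : Prop :=
  if n is m.+1 then exists q, SigmaP m q /\ p = Fall q else Delta0P p.

(** ** KP^P *)

(* In the schemata the tail [r] of the valuation supplies the parameters. *)
Definition Separation (G : formula -> Prop) (M : structure) : Prop :=
  forall p, G p -> forall (r : nat -> M) (x : M),
  exists y : M, forall u : M, u \E y <-> u \E x /\ sat (scons u r) p.

Definition Collection (G : formula -> Prop) (M : structure) : Prop :=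
  forall p, G p -> forall (r : nat -> M) (x : M),
  (forall u : M, u \E x -> exists v : M, sat (scons u (scons v r)) p) ->
  exists y : M, forall u : M, u \E x ->
    exists v : M, v \E y /\ sat (scons u (scons v r)) p.

Definition Foundation (G : formula -> Prop) (M : structure) : Prop :=
  forall p, G p -> forall r : nat -> M,
  (exists x : M, sat (scons x r) p) ->
  exists y : M, sat (scons y r) p /\
    forall v : M, v \E y -> ~ sat (scons v r) p.

Section Internal.
Variable M : structure.
Implicit Types (x y z u v w p f a b g : M).

Definition subset_in x y : Prop := forall z, z \E x -> z \E y.

Definition Extensionality : Prop :=
  forall x y, (forall z, z \E x <-> z \E y) -> x = y.
Definition Pairing : Prop :=
  forall x y, exists z, forall u, u \E z <-> u = x \/ u = y.
Definition Union : Prop :=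
  forall x, exists y, forall u, u \E y <-> exists z, z \E x /\ u \E z.
Definition Powerset : Prop :=
  forall x, exists y, forall u, u \E y <-> subset_in u x.
Definition Infinity : Prop :=
  exists w, (exists e, (forall u, ~ u \E e) /\ e \E w) /\
    forall x, x \E w ->
      exists y, (forall u, u \E y <-> u \E x \/ u = x) /\ y \E w.

Record KPP : Prop := {
  KPP_extensionality : Extensionality;
  KPP_pairing : Pairing;
  KPP_union : Union;
  KPP_powerset : Powerset;
  KPP_infinity : Infinity;
  KPP_separation : Separation Delta0P M;
  KPP_collection : Collection Delta0P M;
  KPP_foundation : Foundation (PiP 1) M }.

Definition nonstandard : Prop := ~ well_founded (@elem M).

(** ** Ordinals, the cumulative hierarchy and rank, as computed inside [M] *)

Definition transitive_in x : Prop := forall y, y \E x -> subset_in y x.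

(* Given Foundation for sets, which KP^P includes, these are the von Neumann
   ordinals. *)
Definition ordinal_in a : Prop :=
  transitive_in a /\ forall b, b \E a -> transitive_in b.

Definition ord_le a b : Prop := a \E b \/ a = b.

Definition is_upair p x y : Prop := forall u, u \E p <-> u = x \/ u = y.

Definition is_opair p x y : Prop :=
  exists u v, [/\ is_upair u x x, is_upair v x y & is_upair p u v].

Definition maps_to f x y : Prop := exists p, is_opair p x y /\ p \E f.

(* [f] is the function with domain a + 1 satisfying the recursion
   f(g) = \bigcup_(d < g) Powerset(f(d)). *)
Definition V_sequence f a : Prop :=
  [/\ forall p, p \E f -> exists x y, ord_le x a /\ is_opair p x y,
      forall g, ord_le g a -> exists! v, maps_to f g v
    & forall g v, maps_to f g v -> forall z,
        z \E v <-> exists d w, [/\ d \E g, maps_to f d w & subset_in z w]].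

(* v = V_a *)
Definition is_V a v : Prop :=
  ordinal_in a /\ exists f, V_sequence f a /\ maps_to f a v.

(* [a] is the least ordinal such that [x] is a subset of V_a. *)
Definition is_rank x a : Prop :=
  (exists v, is_V a v /\ subset_in x v) /\
  forall b v, b \E a -> is_V b v -> ~ subset_in x v.

Definition rank_le x y : Prop :=
  exists a b, [/\ is_rank x a, is_rank y b & ord_le a b].

Definition rank_below b : set M := [set x | exists a, is_rank x a /\ a \E b].

End Internal.

Arguments KPP : clear implicits.
Arguments nonstandard : clear implicits.

(** ** Embeddings *)

Section Embeddings.
Variables M N : structure.
Implicit Types i j : M -> N.

Definition embedding i : Prop :=
  injective i /\ forall x y : M, x \E y <-> i x \E i y.

Definition rank_initial i : Prop :=
  embedding i /\ forall (m : M) (n : N), rank_le n (i m) -> range i n.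

Definition bounded i : Prop :=
  exists a : N, ordinal_in a /\ range i `<=` rank_below a.

Definition topless i : Prop :=
  bounded i /\
  forall b : N, ordinal_in b -> ~ range i b ->
    exists b' : N, [/\ ordinal_in b', ~ range i b' & b' \E b].

Definition rank_cut i : Prop := rank_initial i /\ topless i.

(* Subsets of [M] coded in [N], where [M] is identified with its image. *)
Definition Cod i : set (set M) := [set A | exists c : N, A = [set x | i x \E c]].

(* The second-order structure on the domain of [M] consisting of the membership
   relation of [M] and the coded sets. *)
Definition SSy i : (M -> M -> Prop) * set (set M) := (@elem M, Cod i).

End Embeddings.

Definition substructure (N : structure) (A : set N) : structure :=
  @Structure {x : N | A x} (fun x y => sval x \E sval y).

Definition inclusion (N : structure) (A B : set N) (AB : A `<=` B)
    (x : substructure A) : substructure B :=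
  exist _ (sval x) (AB (sval x) (svalP x)).

(* Rank-initiality is evaluated with the rank function of the substructure on
   the range of [j], not with that of [N]. *)
Definition lt_rank (M N : structure) (i j : M -> N) : Prop :=
  range i `<` range j /\
  exists ij : range i `<=` range j, rank_initial (inclusion ij).

Definition lt_lex (g h : nat -> bool) : Prop :=
  exists n, [/\ forall k, (k < n)%N -> g k = h k, g n = false & h n = true].

(* A common substructure [S] of [M] and [N] is given by a structure with
   embeddings [eM] and [eN] playing the role of the two inclusion maps; that [i]
   fixes [S] pointwise then means that [i] commutes with them. *)
Definition rank_initial_over (S M N : structure) (eM : S -> M) (eN : S -> N)
    (m0 : M) (n0 b : N) (i : M -> N) : Prop :=
  [/\ rank_initial i,
      forall s : S, i (eM s) = eN s,
      i m0 = n0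
    & range i `<=` rank_below b].

(* Main.v *)
Require Import Defs.
From mathcomp Require Import all_boot.
From mathcomp Require Import boolp classical_sets functions cardinality.

Set Implicit Arguments.
Unset Strict Implicit.
Unset Printing Implicit Defensive.

Local Open Scope classical_set_scope.

(** Only (b) => (c) is hard. (a) => (b) holds because bounded quantifiers and
    quantifiers over subsets are absolute along rank-initial embeddings
    ([sat_absolute]), and (c) => (d) is a counting argument: if no range in the
    chain were topless, each would have a least ordinal outside it, and along the
    chain these ordinals are pairwise distinct elements of a countable model.

    For (b) => (c) one first builds a single embedding, by a back-and-forth argument
    in Friedman's style. Usually the invariant, for finite tuples [e] in [M] and
    [e'] in [N], says that every Sigma_1^P fact about [e] with parameters in [S]
    holds of [e'] with a witness bounded in [N], and one needs an internal
    satisfaction predicate to code all such facts by one set. Here formulas are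
    replaced by codes built from the elements of [S] themselves: five kinds of codes
    express that an entry of the tuple equals a given element of [S], that one entry
    is or is not a member of another, that some extension of the tuple satisfies all
    codes of a set [A], and that every extension by a member or a subset of an entry
    satisfies some code of [A]. What a code says is given coinductively: a code is
    true of [e] if the pair lies in a set [W] in which each pair is supported by
    further pairs as the clauses demand ([supported], [witness_set]). Being such a
    [W] is a Delta_0^P property, so truth of codes is Sigma_1^P without any
    recursion theorem or coding of syntax; the clauses hold in both directions
    ([verifies_cases], [verify_forth], [verify_back]) because sets of witnesses can
    be collected and joined.

    The invariant [transfers] now says that every code in [S] that is true of [e] in
    [M] is true of [e'] in [N] with a witness in [B]. To extend it by an element of
    [M] ([forth_step]), Sigma_1^P-Separation in [M] yields a set of the codes true
    of the longer tuple, equality of the standard systems moves its trace on [S] to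
    [N], the invariant yields a suitable element of [N] for each part of this trace
    that belongs to [S], and overspill past the cut ([overspill]) yields one for the
    whole trace. The step in the other direction ([back_step]) is dual and codes the
    false instances instead. In the limit the range contains the members and the
    subsets of its elements; hence the cumulative hierarchy is preserved, and the
    embedding is rank-initial ([closed_rank_initial]).

    A chain indexed by the Cantor space arises from a tree of such embeddings. Given
    an embedding [i] and finitely many elements, some stage [z] of [M] contains
    witnesses for all codes that are true of these elements; by absoluteness, the
    invariant holds with [B := i z], so there is another embedding that agrees with
    [i] on these elements and has its range inside [i z] ([shrink]). At each node
    one branch passes to that embedding, the other keeps [i] and puts [z] on the
    list of elements never moved again. The limits along two branches are then
    separated by [i z]. *)

(** * Definability by bounded formulas *)

(** A predicate given uniformly in all structures is definable in the first [n]
    variables. Working with predicates instead of formulas keeps the schemata usable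
    on statements written with ordinary bound variables: the closure lemmas below
    recover the formula from the shape of the predicate. *)
Definition D0 (n : nat) (P : forall M : structure, (nat -> M) -> Prop) : Prop :=
  exists p, [/\ Delta0P p, free_below n p
    & forall (M : structure) (r : nat -> M), sat r p <-> P M r].

Section Closure.
Implicit Types (n i j : nat).
Implicit Types P : forall M : structure, (nat -> M) -> Prop.

Lemma D0_ext n P P' :
  (forall (M : structure) (r : nat -> M), P M r <-> P' M r) -> D0 n P' -> D0 n P.
Proof.
move=> E [p [dp fp sp]]; exists p; split=> // M r.
by rewrite (propext (sp M r)) (propext (E M r)).
Qed.

Lemma D0_mem n i j : i < n -> j < n -> D0 n (fun M r => r i \E r j).
Proof. by move=> lin ljn; exists (Fmem i j); split=> /=; [constructor | rewrite lin | ]. Qed.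

Lemma D0_eq n i j : i < n -> j < n -> D0 n (fun M r => r i = r j).
Proof. by move=> lin ljn; exists (Feq i j); split=> /=; [constructor | rewrite lin | ]. Qed.

Lemma D0_not n P : D0 n P -> D0 n (fun M r => ~ P M r).
Proof.
move=> [p [dp fp sp]]; exists (Fneg p); split=> //=; first by constructor.
by move=> M r; rewrite (propext (sp M r)).
Qed.

Lemma D0_and n P P' : D0 n P -> D0 n P' -> D0 n (fun M r => P M r /\ P' M r).
Proof.
move=> [p [dp fp sp]] [q [dq fq sq]]; exists (Fand p q).
split=> /=; [by constructor | by rewrite fp | move=> M r].
by rewrite (propext (sp M r)) (propext (sq M r)).
Qed.

Lemma D0_or n P P' : D0 n P -> D0 n P' -> D0 n (fun M r => P M r \/ P' M r).
Proof.
move=> dP dP'; apply: (D0_ext (P' := fun M r => ~ (~ P M r /\ ~ P' M r))).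
  move=> M r; split; first by move=> [] ? [].
  by move=> H; apply: contrapT => /not_orP.
by apply/D0_not/D0_and; exact: D0_not.
Qed.

Lemma D0_imp n P P' : D0 n P -> D0 n P' -> D0 n (fun M r => P M r -> P' M r).
Proof.
move=> dP dP'; apply: (D0_ext (P' := fun M r => ~ P M r \/ P' M r)).
  by move=> M r; split=> [H|[] //]; have [/H|] := EM (P M r); [right|left].
by apply: D0_or => //; exact: D0_not.
Qed.

Lemma D0_and3 n P P' P'' : D0 n P -> D0 n P' -> D0 n P'' ->
  D0 n (fun M r => [/\ P M r, P' M r & P'' M r]).
Proof.
move=> d d' d''; apply: (D0_ext (P' := fun M r => P M r /\ (P' M r /\ P'' M r))).
  by move=> M r; split=> [[]|[? []]].
by do 2 apply: D0_and => //.
Qed.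

Lemma D0_and4 n P P' P'' P3 : D0 n P -> D0 n P' -> D0 n P'' -> D0 n P3 ->
  D0 n (fun M r => [/\ P M r, P' M r, P'' M r & P3 M r]).
Proof.
move=> d d' d'' d3.
apply: (D0_ext (P' := fun M r => P M r /\ [/\ P' M r, P'' M r & P3 M r])).
  by move=> M r; split=> [[]|[? []]].
by apply: D0_and => //; apply: D0_and3.
Qed.

Lemma sat_sub (M : structure) (r : nat -> M) i j :
  sat r (Fsub i j) <-> subset_in (r i) (r j).
Proof.
split=> /= [H z zi|H [z]].
  by apply: contrapT => nz; apply: H; exists z => -[].
by apply => -[/H ? []].
Qed.

Lemma sat_ex_sub (M : structure) (r : nat -> M) j p :
  sat r (Fex_sub j p) <-> exists x, subset_in x (r j) /\ sat (scons x r) p.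
Proof.
by split=> -[x [xj ?]]; exists x; split=> //; apply/(sat_sub (scons x r) 0 j.+1).
Qed.

Lemma sat_all_in (M : structure) (r : nat -> M) j p :
  sat r (Fall_in j p) <-> forall x, x \E r j -> sat (scons x r) p.
Proof.
split=> [H x xj|H [x nx]]; last by apply: nx => -[/H].
by apply: contrapT => np; apply: H; exists x; apply; split.
Qed.

Lemma sat_all_sub (M : structure) (r : nat -> M) j p :
  sat r (Fall_sub j p) <-> forall x, subset_in x (r j) -> sat (scons x r) p.
Proof.
split=> [H x xj|H [x nx]].
  apply: contrapT => np; apply: H; exists x; apply; split=> //.
  exact/(sat_sub (scons x r) 0 j.+1).
by apply: nx => -[/(sat_sub (scons x r) 0 j.+1) /H].
Qed.

(* In a bounded quantifier the matrix is a predicate of the bound variable; under the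
   binder that variable becomes [r 0] and the others are shifted. *)
Section Quantifiers.
Variable Q : forall M : structure, (nat -> M) -> M -> Prop.
Let Q' (M : structure) (r : nat -> M) := Q (fun k => r k.+1) (r 0).

Lemma D0_ex_in n j : j < n -> D0 n.+1 Q' ->
  D0 n (fun M r => exists x, x \E r j /\ Q r x).
Proof.
move=> ljn [p [dp fp sp]]; exists (Fex_in j p).
split=> /=; [by constructor | by rewrite fp !ltnS ljn | move=> M r].
by split=> -[x [xj]] => [/sp|?]; exists x; split=> //; apply/sp.
Qed.

Lemma D0_ex_sub n j : j < n -> D0 n.+1 Q' ->
  D0 n (fun M r => exists x, subset_in x (r j) /\ Q r x).
Proof.
move=> ljn [p [dp fp sp]]; exists (Fex_sub j p).
split; [by constructor | by rewrite /= fp !ltnS ljn | move=> M r].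
rewrite (propext (sat_ex_sub r j p)).
by split=> -[x [xj]] => [/sp|?]; exists x; split=> //; apply/sp.
Qed.

End Quantifiers.

Lemma D0_all_in n j (Q : forall M : structure, (nat -> M) -> M -> Prop) :
  j < n -> D0 n.+1 (fun M r => Q M (fun k => r k.+1) (r 0)) ->
  D0 n (fun M r => forall x, x \E r j -> Q M r x).
Proof.
move=> ljn dQ.
apply: (D0_ext (P' := fun M r => ~ (exists x, x \E r j /\ ~ Q M r x))).
  move=> M r; split=> [H [x [/H]] //|H x xj].
  by apply: contrapT => ?; apply: H; exists x.
by apply/D0_not/D0_ex_in => //; exact: D0_not.
Qed.

Lemma D0_all_sub n j (Q : forall M : structure, (nat -> M) -> M -> Prop) :
  j < n -> D0 n.+1 (fun M r => Q M (fun k => r k.+1) (r 0)) ->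
  D0 n (fun M r => forall x, subset_in x (r j) -> Q M r x).
Proof.
move=> ljn dQ.
apply: (D0_ext (P' := fun M r => ~ (exists x, subset_in x (r j) /\ ~ Q M r x))).
  move=> M r; split=> [H [x [/H]] //|H x xj].
  by apply: contrapT => ?; apply: H; exists x.
by apply/D0_not/D0_ex_sub => //; exact: D0_not.
Qed.

Lemma D0_subset n i j : i < n -> j < n -> D0 n (fun M r => subset_in (r i) (r j)).
Proof. by move=> lin ljn; apply: D0_all_in => //; exact: D0_mem. Qed.

Lemma D0_transitive n i : i < n -> D0 n (fun M r => transitive_in (r i)).
Proof. by move=> lin; apply: D0_all_in => //; exact: D0_subset. Qed.

Lemma D0_ordinal n i : i < n -> D0 n (fun M r => ordinal_in (r i)).
Proof.
move=> lin; apply: D0_and; first exact: D0_transitive.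
by apply: D0_all_in => //; exact: D0_transitive.
Qed.

Lemma D0_ord_le n i j : i < n -> j < n -> D0 n (fun M r => ord_le (r i) (r j)).
Proof. by move=> *; apply: D0_or; [exact: D0_mem | exact: D0_eq]. Qed.

Lemma D0_upair n i j k : i < n -> j < n -> k < n ->
  D0 n (fun M r => is_upair (r i) (r j) (r k)).
Proof.
move=> lin ljn lkn.
apply: (D0_ext (P' := fun M r => [/\ r j \E r i, r k \E r i
   & forall u, u \E r i -> u = r j \/ u = r k])).
  move=> M r; split=> [H|[H1 H2 H3] u].
    by split=> [||u /H //]; apply/H; [left|right].
  by split=> [/H3 //|[] ->].
apply: D0_and3; [exact: D0_mem | exact: D0_mem | apply: D0_all_in => //].
by apply: D0_or; exact: D0_eq.
Qed.

Lemma D0_opair n i j k : i < n -> j < n -> k < n ->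
  D0 n (fun M r => is_opair (r i) (r j) (r k)).
Proof.
move=> lin ljn lkn.
apply: (D0_ext (P' := fun M r => exists u, u \E r i /\ exists v, v \E r i /\
   [/\ is_upair u (r j) (r j), is_upair v (r j) (r k) & is_upair (r i) u v])).
  move=> M r; split=> [[u [v [H1 H2 H3]]]|[u [_ [v [_ ?]]]]]; last by exists u, v.
  by exists u; split; [apply/H3; left|exists v; split=> //; apply/H3; right].
do 2 apply: D0_ex_in => //.
by apply: D0_and3; apply: D0_upair.
Qed.

(** The components of a pair [p] are members of members of [p], which makes the
    quantifiers bounded; the sets in between account for the shift by four. *)
Lemma D0_ex_opair n i (Q : forall M : structure, (nat -> M) -> M -> M -> Prop) :
  i < n -> D0 n.+4 (fun M r => Q M (fun k => r k.+4) (r 2) (r 0)) ->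
  D0 n (fun M r => exists x y, is_opair (r i) x y /\ Q M r x y).
Proof.
move=> lin dQ.
apply: (D0_ext (P' := fun M r => exists c, c \E r i /\ exists x, x \E c /\
   exists d, d \E r i /\ exists y, y \E d /\ (is_opair (r i) x y /\ Q M r x y))).
  move=> M r; split=> [[x [y [[u [v [H1 H2 H3]]] q]]]|[c [_ [x [_ [d [_ [y [_ ?]]]]]]]]];
    last by exists x, y.
  exists u; split; first by apply/H3; left.
  exists x; split; first by apply/H1; left.
  exists v; split; first by apply/H3; right.
  exists y; split; first by apply/H2; right.
  by split=> //; exists u, v.
do 4 apply: D0_ex_in => //.
by apply: D0_and; [exact: D0_opair|].
Qed.

Lemma D0_maps_to n i j k : i < n -> j < n -> k < n ->
  D0 n (fun M r => maps_to (r i) (r j) (r k)).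
Proof.
move=> lin ljn lkn.
apply: (D0_ext (P' := fun M r => exists p, p \E r i /\ is_opair p (r j) (r k))).
  by move=> M r; split=> -[p []]; exists p.
by apply: D0_ex_in => //; exact: D0_opair.
Qed.

Lemma D0_ex_maps n i (Q : forall M : structure, (nat -> M) -> M -> M -> Prop) :
  i < n -> D0 n.+1.+4 (fun M r => Q M (fun k => r k.+1.+4) (r 2) (r 0)) ->
  D0 n (fun M r => exists x y, maps_to (r i) x y /\ Q M r x y).
Proof.
move=> lin dQ.
apply: (D0_ext (P' := fun M r => exists p, p \E r i /\
   exists x y, is_opair p x y /\ Q M r x y)).
  move=> M r; split=> [[x [y [[p [? ?]] ?]]]|[p [? [x [y [? ?]]]]]].
    by exists p; split=> //; exists x, y.
  by exists x, y; split=> //; exists p.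
by apply: D0_ex_in => //; apply: D0_ex_opair.
Qed.

Lemma D0_all_maps n i (Q : forall M : structure, (nat -> M) -> M -> M -> Prop) :
  i < n -> D0 n.+1.+4 (fun M r => Q M (fun k => r k.+1.+4) (r 2) (r 0)) ->
  D0 n (fun M r => forall x y, maps_to (r i) x y -> Q M r x y).
Proof.
move=> lin dQ.
apply: (D0_ext (P' := fun M r => ~ exists x y, maps_to (r i) x y /\ ~ Q M r x y)).
  move=> M r; split=> [H [x [y [/H]]] //|H x y xy].
  by apply: contrapT => ?; apply: H; exists x, y.
by apply/D0_not/D0_ex_maps => //; exact: D0_not.
Qed.

End Closure.

(* Predicates recognized by name, tried before the shape of their body: the lemmas for
   connectives would otherwise unfold them. *)
Ltac known_definable := fail.

(* Follows the shape of the predicate. *)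
Ltac definability := repeat first
  [ done | known_definable | apply: D0_mem | apply: D0_eq | apply: D0_subset | apply: D0_transitive
  | apply: D0_ordinal | apply: D0_ord_le | apply: D0_upair | apply: D0_opair
  | apply: D0_maps_to
  | apply: D0_ex_opair | apply: D0_ex_maps | apply: D0_all_maps
  | apply: D0_ex_in | apply: D0_all_in | apply: D0_ex_sub | apply: D0_all_sub
  | apply: D0_and3 | apply: D0_and4 | apply: D0_and | apply: D0_or | apply: D0_not
  | apply: D0_imp ].

(** All sets that the recursion for the hierarchy speaks about are components of
    pairs in [f]. *)
Lemma D0_V_sequence n i j : i < n -> j < n ->
  D0 n (fun M r => V_sequence (r i) (r j)).
Proof.
move=> lin ljn.
apply: (D0_ext (P' := fun M r =>
 [/\ forall p, p \E r i -> exists x y, is_opair p x y /\ ord_le x (r j),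
     forall g, g \E r j -> exists x v, maps_to (r i) x v /\ (x = g /\
       forall x' v', maps_to (r i) x' v' -> x' = g -> v = v'),
     exists x v, maps_to (r i) x v /\ (x = r j /\
       forall x' v', maps_to (r i) x' v' -> x' = r j -> v = v')
   & forall g v, maps_to (r i) g v ->
       (forall z, z \E v -> exists d w, maps_to (r i) d w /\ (d \E g /\ subset_in z w)) /\
       (forall d w, maps_to (r i) d w -> d \E g -> forall z, subset_in z w -> z \E v)])).
  move=> M r; split.
    move=> [H1 H2 H3]; split.
    - by move=> p /H1 [x [y []]]; exists x, y.
    - move=> g gj; case: (H2 g); first by left.
      move=> v [gv vu]; exists g, v; do 2 split=> //.
      by move=> x' v' + ex'; rewrite ex' => /vu.
    - case: (H2 (r j)); first by right.
      move=> v [gv vu]; exists (r j), v; do 2 split=> //.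
      by move=> x' v' + ex'; rewrite ex' => /vu.
    - move=> g v gv; split=> [z /(H3 _ _ gv)[d [w []]]|d w dw dg z zw].
        by exists d, w.
      by apply/(H3 _ _ gv); exists d, w.
  move=> [H1 H2 H2' H3]; split.
  - by move=> p /H1 [x [y []]]; exists x, y.
  - move=> g [gj|gj].
      have [x [v [xv [ex vu]]]] := H2 _ gj.
      by exists v; split=> [|v' gv']; [rewrite ?gj -ex | apply: vu gv' _].
    have [x [v [xv [ex vu]]]] := H2'.
    by exists v; split=> [|v' gv']; [rewrite ?gj -ex | apply: vu gv' _].
  - move=> g v gv z; have [H4 H5] := H3 _ _ gv; split=> [/H4 [d [w [? []]]]|].
      by exists d, w.
    by move=> [d [w [dg dw zw]]]; exact: H5 dw dg _ zw.
definability.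
Qed.

Ltac known_definable ::= apply: D0_V_sequence.


(** * Absoluteness *)

(** This is what the back-and-forth construction yields directly, and it suffices
    for absoluteness. Unlike rank-initiality it does not mention ranks; for models
    of KP^P the two notions agree ([rank_initial_closed], [closed_rank_initial]). *)
Definition closed_embedding (M N : structure) (i : M -> N) : Prop :=
  [/\ embedding i, forall x n, n \E i x -> range i n
    & forall x n, subset_in n (i x) -> range i n].

Section Absoluteness.
Variables (M N : structure) (i : M -> N).
Hypothesis ci : closed_embedding i.

Lemma closed_inj : injective i. Proof. by case: ci => -[]. Qed.

Lemma closed_mem x y : x \E y <-> i x \E i y. Proof. by case: ci => -[] _ H _ _; exact: H. Qed.

Lemma closed_in x n : n \E i x -> exists2 y, y \E x & i y = n.
Proof.
case: ci => _ H _ nx; have [y _ yn] := H _ _ nx.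
by exists y => //; apply/closed_mem; rewrite yn.
Qed.

Lemma closed_subset x y : subset_in x y <-> subset_in (i x) (i y).
Proof.
split=> [xy n /closed_in[z zx <-]|xy z /closed_mem /xy /closed_mem //].
by apply/closed_mem/xy.
Qed.

Lemma closed_sub x n : subset_in n (i x) -> exists2 y, subset_in y x & i y = n.
Proof.
case: ci => _ _ H nx; have [y _ yn] := H _ _ nx.
by exists y => //; apply/closed_subset; rewrite yn.
Qed.

Lemma comp_scons x (r : nat -> M) : i \o scons x r = scons (i x) (i \o r).
Proof. by apply/funext => -[]. Qed.

Lemma sat_absolute p : Delta0P p ->
  forall r : nat -> M, sat r p <-> sat (i \o r) p.
Proof.
elim=> {p}.
- by move=> x y r /=; exact: closed_mem.
- by move=> x y r /=; split=> [->|/closed_inj].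
- by move=> p _ IH r /=; rewrite (propext (IH r)).
- by move=> p q _ IHp _ IHq r /=; rewrite (propext (IHp r)) (propext (IHq r)).
- move=> y p _ IH r /=; split=> -[x [xy]].
    by move=> /IH; rewrite comp_scons => ?; exists (i x); split=> //; apply/closed_mem.
  have [z zy <-] := closed_in xy.
  by rewrite -comp_scons => /IH ?; exists z.
- move=> y p _ IH r; rewrite (propext (sat_all_in r y p)) (propext (sat_all_in _ y p)).
  split=> H x xy; last by apply/IH; rewrite comp_scons; apply/H/closed_mem.
  by have [z /H/IH + <-] := closed_in xy; rewrite comp_scons.
- move=> y p _ IH r; rewrite (propext (sat_ex_sub r y p)) (propext (sat_ex_sub _ y p)).
  split=> -[x [xy]].
    by move=> /IH; rewrite comp_scons => ?; exists (i x); split=> //; apply/closed_subset.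
  by have [z zy <-] := closed_sub xy; rewrite -comp_scons => /IH ?; exists z.
- move=> y p _ IH r; rewrite (propext (sat_all_sub r y p)) (propext (sat_all_sub _ y p)).
  split=> H x xy; last by apply/IH; rewrite comp_scons; apply/H/closed_subset.
  by have [z /H/IH + <-] := closed_sub xy; rewrite comp_scons.
Qed.

Lemma D0_absolute n P : D0 n P -> forall r : nat -> M, P M r <-> P N (i \o r).
Proof.
move=> [p [dp _ sp]] r.
by rewrite -(propext (sp M r)) -(propext (sp N _)); exact: sat_absolute.
Qed.

End Absoluteness.

(** * Elementary set theory in a model of KP^P *)

Section SetTheory.
Variable M : structure.
Hypothesis HM : KPP M.
Implicit Types (x y z u v w p f a b c d g : M).

Lemma extensionality x y : (forall z, z \E x <-> z \E y) -> x = y.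
Proof. exact: KPP_extensionality. Qed.

Lemma separation0 n P : D0 n P -> forall r x,
  exists y, forall u, u \E y <-> u \E x /\ P M (scons u r).
Proof.
move=> [p [dp _ sp]] r x; have [y yP] := KPP_separation HM dp r x.
by exists y => u; rewrite yP (propext (sp M _)).
Qed.

Lemma collection0 n P : D0 n P -> forall r x,
  (forall u, u \E x -> exists v, P M (scons u (scons v r))) ->
  exists y, forall u, u \E x -> exists v, v \E y /\ P M (scons u (scons v r)).
Proof.
move=> [p [dp _ sp]] r x H.
have [u /H[v ?]|y yP] := KPP_collection HM dp (r := r) (x := x).
  by exists v; apply/sp.
by exists y => u /yP[v [? ?]]; exists v; split=> //; apply/sp.
Qed.

(** The least counterexample to a Sigma_1^P property is one to a Pi_1^P property, so
    Pi_1^P-Foundation applies. *)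
Lemma sigma1_induction n P : D0 n P -> forall r,
  (forall x, (forall v, v \E x -> exists w, P M (scons w (scons v r))) ->
     exists w, P M (scons w (scons x r))) ->
  forall x, exists w, P M (scons w (scons x r)).
Proof.
move=> [p [dp _ sp]] r H x; apply: contrapT => nx.
have pp : PiP 1 (Fall (Fneg p)) by exists (Fneg p); split=> //; constructor.
have E y : sat (scons y r) (Fall (Fneg p)) <->
    ~ exists w, P M (scons w (scons y r)).
  split=> [/= H' [w /sp ?]|H' [w /= nn]]; first by apply: H'; exists w => nn; apply: nn.
  by apply: H'; exists w; apply/sp; apply: contrapT.
have [|y [/E ny]] := KPP_foundation HM pp (r := r); first by exists x; apply/E.
by move=> vy; apply: ny; apply: H => v /vy vP; apply: contrapT => /E.
Qed.

(** Membership in [x] is a bounded formula, so the witness that the induction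
    principle asks for is a dummy. *)
Lemma regular x : (exists y, y \E x) ->
  exists y, y \E x /\ forall v, v \E y -> ~ v \E x.
Proof.
move=> [y yx]; apply: contrapT => H.
have d : D0 3 (fun M r => ~ r 1 \E r 2) by definability.
suff /(_ y)[_ /(_ yx)] : forall y, exists _ : M, ~ y \E x by [].
apply: (sigma1_induction d (r := fun _ => x)) => /= z IH; exists z => zx.
by apply: H; exists z; split=> // v /IH[].
Qed.


Lemma exists_empty : exists e, forall u, ~ u \E e.
Proof. by have [w [[e [eP _]] _]] := KPP_infinity HM; exists e. Qed.

Definition mempty : M := sval (cid exists_empty).
Definition upair x y : M := sval (cid (KPP_pairing HM x y)).
Definition union x : M := sval (cid (KPP_union HM x)).
Definition power x : M := sval (cid (KPP_powerset HM x)).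
Definition sing x := upair x x.
Definition opair x y := upair (sing x) (upair x y).
Definition cup x y := union (upair x y).
Definition succ x := cup x (sing x).

Lemma memptyE u : ~ u \E mempty.
Proof. by rewrite /mempty; case: cid. Qed.

Lemma upairP x y : is_upair (upair x y) x y.
Proof. by rewrite /upair; case: cid. Qed.

Lemma upairE x y u : u \E upair x y <-> u = x \/ u = y.
Proof. exact: upairP. Qed.

Lemma unionE x u : u \E union x <-> exists z, z \E x /\ u \E z.
Proof. by rewrite /union; case: cid. Qed.

Lemma powerE x u : u \E power x <-> subset_in u x.
Proof. by rewrite /power; case: cid. Qed.

Lemma singE x u : u \E sing x <-> u = x.
Proof. by rewrite upairE; split=> [[]|->]; auto. Qed.

Lemma cupE x y u : u \E cup x y <-> u \E x \/ u \E y.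
Proof.
rewrite unionE; split=> [[z [/upairE[] ->]]|[] ?]; [by left|by right| |].
  by exists x; split=> //; apply/upairE; left.
by exists y; split=> //; apply/upairE; right.
Qed.

Lemma succE x u : u \E succ x <-> ord_le u x.
Proof. by rewrite cupE singE. Qed.

Lemma opairP x y : is_opair (opair x y) x y.
Proof. by exists (sing x), (upair x y); split; exact: upairP. Qed.

Lemma upair_eq z x y : is_upair z x y -> z = upair x y.
Proof. by move=> H; apply: extensionality => u; rewrite upairE. Qed.

Lemma opair_eq z x y : is_opair z x y -> z = opair x y.
Proof. by move=> [u [v [/upair_eq -> /upair_eq -> /upair_eq]]]. Qed.

Lemma upair_inj x y x' y' : upair x y = upair x' y' ->
  (x = x' /\ y = y') \/ (x = y' /\ y = x').
Proof.
move=> E; have := upairE x y; rewrite E => H.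
have /H := (upairE x' y' x').2 (or_introl erefl).
have /H := (upairE x' y' y').2 (or_intror erefl).
have /upairE := (H x).2 (or_introl erefl).
have /upairE := (H y).2 (or_intror erefl).
by do 4 case=> ?; subst; auto.
Qed.

Lemma opair_inj x y x' y' : opair x y = opair x' y' -> x = x' /\ y = y'.
Proof.
move=> /upair_inj [] [] /upair_inj H /upair_inj H'.
  have ex : x = x' by case: H => -[].
  by subst; split=> //; case: H' => -[] // <- ->.
by case: H => -[e1 e2]; subst; case: H' => -[e3 e4]; subst.
Qed.

Lemma is_opair_inj p x y x' y' : is_opair p x y -> is_opair p x' y' ->
  x = x' /\ y = y'.
Proof. by move=> /opair_eq -> /opair_eq/opair_inj. Qed.

Lemma mapsE f x y : maps_to f x y <-> opair x y \E f.
Proof.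
split=> [[p [/opair_eq -> //]]|H]; exists (opair x y); split=> //.
exact: opairP.
Qed.

Lemma no_self x : ~ x \E x.
Proof.
move=> xx; have [|y [/singE -> /(_ x)]] := @regular (sing x).
  by exists x; apply/singE.
by move=> /(_ xx); apply; apply/singE.
Qed.

Lemma no_two_cycle x y : x \E y -> ~ y \E x.
Proof.
move=> xy yx; have [|z [/upairE[] ->]] := @regular (upair x y).
- by exists x; apply/upairE; left.
- by move=> /(_ y yx); apply; apply/upairE; right.
- by move=> /(_ x xy); apply; apply/upairE; left.
Qed.


Lemma ord_mem a b : ordinal_in a -> b \E a -> ordinal_in b.
Proof.
move=> [ta oa] ba; split; first exact: oa.
by move=> c cb; apply: oa; exact: ta cb.
Qed.

Lemma ord_trans a b c : ordinal_in a -> b \E a -> c \E b -> c \E a.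
Proof. by move=> [ta _] ba cb; exact: ta cb. Qed.

Lemma ord_le_trans a b c : ordinal_in a -> ord_le b a -> ord_le c b -> ord_le c a.
Proof.
move=> oa [ba|->] // [cb|->]; [|by left].
by left; exact: ord_trans cb.
Qed.

(** Take [x0] minimal in [succ a] among the ordinals incomparable to some element of
    [succ b], then [y0] minimal in [succ b] among those incomparable to [x0]. By
    minimality the elements of either are comparable to the other, hence belong to
    it, and [x0 = y0]. *)
Lemma ord_total a b : ordinal_in a -> ordinal_in b -> [\/ a \E b, a = b | b \E a].
Proof.
move=> oa ob; apply: contrapT => nab.
pose cmp a b := [\/ a \E b, a = b | b \E a].
have dB : D0 3 (fun M r => ~ (r 1 \E r 0 \/ r 1 = r 0 \/ r 0 \E r 1)) by definability.
have dA : D0 3 (fun M r =>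
    exists k, k \E r 1 /\ ~ (r 0 \E k \/ r 0 = k \/ k \E r 0)) by definability.
have cE x y : cmp x y <-> x \E y \/ x = y \/ y \E x.
  by split=> [[]|[|[]]] ?; [left|right; left|right; right|exact: Or31|exact: Or32|exact: Or33].
have [A /= AE] := separation0 dA (fun _ => succ b) (succ a).
have aA : exists x, x \E A.
  exists a; apply/AE; split; first by apply/succE; right.
  by exists b; split; [apply/succE; right | move=> /cE].
have [x0 [/AE[x0a [y [yb ny]]] x0m]] := regular aA.
have [B /= BE] := separation0 dB (fun _ => x0) (succ b).
have yB : exists y, y \E B.
  by exists y; apply/BE.
have [y0 [/BE[y0b ny0] y0m]] := regular yB.
have ole c d : ordinal_in c -> d \E succ c -> ordinal_in d.
  by move=> oc /succE [/(ord_mem oc)|->].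
have ox0 := ole _ _ oa x0a; have oy0 := ole _ _ ob y0b.
have ny0' := ny0.
have cx z : z \E x0 -> z \E y0 \/ z = y0 \/ y0 \E z.
  move=> zx; apply: contrapT => nz; apply: (x0m _ zx); apply/AE; split.
    by apply/succE; apply: ord_le_trans oa _ (or_introl zx); apply/succE.
  by exists y0.
have cy z : z \E y0 -> x0 \E z \/ x0 = z \/ z \E x0.
  move=> zy; apply: contrapT => nz; apply: (y0m _ zy); apply/BE; split=> //.
  by apply/succE; apply: ord_le_trans ob _ (or_introl zy); apply/succE.
apply: ny0; right; left; apply: extensionality => z; split=> [zx|zy].
  case: (cx _ zx) => [//|[E|yz]]; case: (ny0').
    by right; right; rewrite -E.
  by right; right; exact: ord_trans yz.
case: (cy _ zy) => [xz|[E|//]]; case: (ny0').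
  by left; exact: ord_trans xz.
by left; rewrite E.
Qed.

End SetTheory.

(** * The cumulative hierarchy and rank *)

Section Hierarchy.
Variable M : structure.
Hypothesis HM : KPP M.
Implicit Types (x y z u v w p f a b c d g : M).

Local Notation no_self := (no_self HM).
Local Notation succ := (succ HM).
Local Notation opair := (opair HM).
Local Notation union := (union HM).
Local Notation power := (power HM).
Local Notation cup := (cup HM).
Local Notation sing := (sing HM).

Lemma ord_succ a : ordinal_in a -> ordinal_in (succ a).
Proof.
move=> oa; split.
  by move=> b /succE ba c cb; apply/succE; left; case: ba => [/(ord_trans oa)|<-]; auto.
by move=> b /succE [/(ord_mem oa)|->] ; [case|case: oa].
Qed.

Lemma ord_union x : (forall a, a \E x -> ordinal_in a) -> ordinal_in (union x).
Proof.
move=> H; split.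
  move=> b /unionE [a [ax ba]] c cb; apply/unionE; exists a; split=> //.
  exact: ord_trans (H _ ax) ba cb.
by move=> b /unionE [a [ax ba]]; have [] := ord_mem (H _ ax) ba.
Qed.

Lemma ord_least x : (forall a, a \E x -> ordinal_in a) -> (exists a, a \E x) ->
  exists a, a \E x /\ forall b, b \E x -> ord_le a b.
Proof.
move=> ox /(regular HM)[a [ax am]]; exists a; split=> // b bx.
by case: (ord_total HM (ox _ ax) (ox _ bx)) => [||/am //]; [left|right].
Qed.

Lemma V_dom f a x v : V_sequence f a -> maps_to f x v -> ord_le x a.
Proof.
move=> [H _ _] [p [pxv /H[x' [v' [xa px'v']]]]].
by have [-> _] := is_opair_inj HM pxv px'v'.
Qed.

(** At the least ordinal where two such sequences differ, the recursion gives both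
    the same value. *)
Lemma V_agree f a f' a' : ordinal_in a -> ordinal_in a' ->
  V_sequence f a -> V_sequence f' a' ->
  forall g v v', maps_to f g v -> maps_to f' g v' -> v = v'.
Proof.
move=> oa oa' Hf Hf' g v v' gv gv'; apply: contrapT => nv.
have dX : D0 3 (fun M r => exists k l, maps_to (r 1) k l /\
  exists k' l', maps_to (r 2) k' l' /\ [/\ k = r 0, k' = r 0 & l <> l']) by definability.
have [X XE] := separation0 HM dX (scons f (fun _ => f')) (succ a).
have {}XE g0 : g0 \E X <-> exists v v', [/\ maps_to f g0 v, maps_to f' g0 v' & v <> v'].
  rewrite XE /=; split=> [[_ [k [l [kl [k' [l' [kl' [ek ek' ll]]]]]]]]|[l [l' [kl kl' ll]]]].
    by subst; exists l, l'.
  split; first by apply/succE; exact: V_dom kl.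
  by exists g0, l; split=> //; exists g0, l'.
have [|{nv gv gv'}g [/XE[{}v [{}v' [gv gv' nv]]] gm]] := @regular _ HM X.
  by exists g; apply/XE; exists v, v'.
apply: nv; case: Hf Hf' (Hf) (Hf') => _ D E [_ D' E'] Hf Hf'.
apply: extensionality => // z; rewrite (E _ _ gv) (E' _ _ gv').
have agr d w w' : d \E g -> maps_to f d w -> maps_to f' d w' -> w = w'.
  move=> dg dw dw'; apply: contrapT => nw; apply: (gm _ dg).
  by apply/XE; exists w, w'.
split=> -[d [w [dg dw zw]]].
  have [|w' [dw' _]] := D' d.
    by apply: ord_le_trans (V_dom Hf' gv') (or_introl dg).
  by exists d, w'; split=> //; rewrite -(agr _ _ _ dg dw dw').
have [|w' [dw' _]] := D d.
  by apply: ord_le_trans (V_dom Hf gv) (or_introl dg).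
by exists d, w'; split=> //; rewrite (agr _ _ _ dg dw' dw).
Qed.

Lemma V_restrict f a g : ordinal_in a -> V_sequence f a -> g \E a ->
  exists f', V_sequence f' g /\ forall x v, maps_to f' x v <-> maps_to f x v /\ ord_le x g.
Proof.
move=> oa Hf ga.
have dF : D0 2 (fun M r => exists k l, is_opair (r 0) k l /\ ord_le k (r 1)) by definability.
have [f' f'E] := separation0 HM dF (fun _ => g) f.
have mE x v : maps_to f' x v <-> maps_to f x v /\ ord_le x g.
  split=> [[p [xv /f'E/= [pf [k [l [kl kg]]]]]]|[[p [xv pf]] xg]].
    by split; [exists p|rewrite (is_opair_inj HM xv kl).1].
  by exists p; split=> //; apply/f'E; split=> //=; exists x, v.
exists f'; split=> //; case: (Hf) => D1 D2 D3; split.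
- by move=> p /f'E /= [_ [x [v [? ?]]]]; exists x, v.
- move=> d dg; have [|v [dv vu]] := D2 d.
    by apply: ord_le_trans dg => //; left.
  by exists v; split=> [|v' /mE[/vu //]]; apply/mE.
- move=> d v /mE[dv dg] z; rewrite (D3 _ _ dv).
  split=> -[b [w [bd bw zw]]]; exists b, w; split=> //; last by case/mE: bw.
  by apply/mE; split=> //; apply: ord_le_trans dg (or_introl bd); exact: ord_mem ga.
Qed.

Lemma is_V_ord a v : is_V a v -> ordinal_in a. Proof. by case. Qed.

Lemma is_V_uniq a v v' : is_V a v -> is_V a v' -> v = v'.
Proof. by move=> [oa [f [Hf fv]]] [_ [f' [Hf' fv']]]; exact: (V_agree oa oa Hf Hf' fv fv'). Qed.

Lemma is_V_seq f a g v : ordinal_in a -> V_sequence f a -> maps_to f g v -> is_V g v.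
Proof.
move=> oa Hf gv; case: (V_dom Hf gv) => [ga|e]; last by subst; split=> //; exists f.
split; first exact: ord_mem ga.
have [f' [Hf' mE]] := V_restrict oa Hf ga; exists f'; split=> //.
by apply/mE; split=> //; right.
Qed.

(** With this, most arguments about the stages need not look at the sequences that
    compute them. *)
Lemma is_V_memE a v z : is_V a v ->
  z \E v <-> exists d w, [/\ d \E a, is_V d w & subset_in z w].
Proof.
move=> [oa [f [Hf av]]]; case: (Hf) => _ D2 D3; rewrite (D3 _ _ av).
split=> -[d [w [da dw zw]]]; exists d, w; split=> //; first exact: (is_V_seq oa Hf dw).
have [|w' [dw' _]] := D2 d; first by left.
by have <- := is_V_uniq (is_V_seq oa Hf dw') dw.
Qed.

(** The sequences for the elements of [a] agree, so their union [h] is a function on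
    [a], and [v], the next stage, is included in a set obtained from [h]. *)
Lemma V_extend (a : M) : ordinal_in a -> (forall d, d \E a -> exists f, V_sequence f d) ->
  exists f, V_sequence f a.
Proof.
move=> oa IH.
have dC : D0 3 (fun M r => V_sequence (r 1) (r 0)) by apply: D0_V_sequence.
have [|Y YE] := collection0 HM dC (r := fun _ => a) (x := a); first exact: IH.
have /= {}YE := YE.
have dF : D0 3 (fun M r => exists k, k \E r 1 /\ V_sequence (r 0) k).
  by definability.
have [F /= FE] := separation0 HM dF (fun _ => a) Y.
pose h := union F.
have hE x v : maps_to h x v <-> x \E a /\ is_V x v.
  split=> [[p [xv /unionE[f [/FE[fY [d [da Hf]]] pf]]]]|[xa xv]].
    have mf : maps_to f x v by exists p.
    have od := ord_mem oa da.
    split; last exact: (is_V_seq od Hf mf).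
    by case: (V_dom Hf mf) => [xd|->] //; exact: ord_trans oa da xd.
  have [f [fY Hf]] := YE _ xa; have ox := ord_mem oa xa.
  case: (Hf) => _ /(_ x (or_intror erefl))[v' [xv' _]] _.
  have e := is_V_uniq (is_V_seq ox Hf xv') xv; subst.
  case: xv' => p [xv' pf]; exists p; split=> //; apply/unionE; exists f; split=> //.
  by apply/FE; split=> //; exists x.
have dv : D0 3 (fun M r => exists k l, maps_to (r 1) k l /\ subset_in (r 0) l) by definability.
have [v vE] := separation0 HM dv (fun _ => h) (power (union (union (union h)))).
have {}vE z : z \E v <-> exists d w, [/\ d \E a, is_V d w & subset_in z w].
  rewrite vE /=; split=> [[_ [d [w [/hE[da dw] zw]]]]|[d [w [da dw zw]]]].
    by exists d, w.
  have dwh : maps_to h d w by apply/hE.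
  split; last by exists d, w.
  apply/powerE => y /zw yw; apply/unionE; exists w; split=> //.
  have /mapsE dwh' := dwh; apply/unionE; exists (upair HM d w).
  by split; [apply/unionE; exists (opair d w); split=> //|]; apply/upairE; right.
pose f := cup h (sing (opair a v)).
have fE x u : maps_to f x u <-> (x \E a /\ is_V x u) \/ (x = a /\ u = v).
  rewrite (mapsE HM) cupE -(mapsE HM) hE singE.
  by split=> [[|/opair_inj]|[|[-> ->]]]; auto.
exists f; split.
- move=> p /cupE[/unionE[f' [/FE[_ [d [da Hf']]] pf']]|/singE ->].
    case: (Hf') => /(_ _ pf') [x [y [xd pxy]]] _ _; exists x, y; split=> //.
    by left; case: xd => [/(ord_trans oa)|->]; auto.
  by exists a, v; split; [right|exact: opairP].
- move=> g [ga|->].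
    have [f' [_ Hf']] := YE _ ga.
    case: (Hf') => _ /(_ g (or_intror erefl))[v' [gv' _]] _.
    have Vv' := is_V_seq (ord_mem oa ga) Hf' gv'.
    exists v'; split=> [|v'' /fE[[_ Vv'']|[e _]]]; first by apply/fE; left.
      exact: is_V_uniq Vv' Vv''.
    by subst; case: (no_self ga).
  exists v; split=> [|v' /fE[[/no_self //]|[]//]]; by apply/fE; right.
- move=> g u /fE [[ga Vu] z|[-> ->] z].
    rewrite (is_V_memE z Vu); split=> -[d [w [dg dw zw]]]; exists d, w; split=> //.
      by apply/fE; left; split=> //; exact: ord_trans dg.
    case/fE: dw => [[]//|[e _]]; subst.
    by case: (no_two_cycle HM ga dg).
  rewrite vE; split=> -[d [w [dg dw zw]]]; exists d, w; split=> //.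
    by apply/fE; left.
  by case/fE: dw => [[]//|[e _]]; subst; case: (no_self dg).
Qed.

Lemma V_total a : ordinal_in a -> exists v, is_V a v.
Proof.
move=> oa; suff [f Hf] : exists f, V_sequence f a.
  case: (Hf) => _ /(_ a (or_intror erefl))[v [av _]] _.
  by exists v; exact: (is_V_seq oa Hf av).
have d : D0 2 (fun M r => ordinal_in (r 1) -> V_sequence (r 0) (r 1)).
  by definability.
have [x IH|f] := sigma1_induction HM d (r := fun _ => a) _ a; last by exists f; auto.
have [ox|nox] := EM (ordinal_in x); last by exists x.
have [|f ?] := V_extend ox _; last by exists f.
by move=> b bx; have [f Hf] := IH _ bx; exists f; apply: Hf; exact: ord_mem bx.
Qed.


Lemma V_subset_mono a b v w : is_V a v -> is_V b w -> ord_le a b -> subset_in v w.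
Proof.
move=> Va Vb ab z /(is_V_memE _ Va)[d [u [da du zu]]].
apply/(is_V_memE _ Vb); exists d, u; split=> //.
by case: ab => [ab|<-] //; exact: ord_trans (is_V_ord Vb) ab da.
Qed.

Lemma V_sub_mem a b v w x : is_V a v -> is_V b w -> a \E b -> subset_in x v -> x \E w.
Proof. by move=> Va Vb ab xv; apply/(is_V_memE _ Vb); exists a, v. Qed.

Lemma V_closed_sub a v x y : is_V a v -> x \E v -> subset_in y x -> y \E v.
Proof.
move=> Va /(is_V_memE _ Va)[d [w [da dw xw]]] yx.
by apply/(is_V_memE _ Va); exists d, w; split=> // z /yx/xw.
Qed.

Lemma V_transitive a v : is_V a v -> transitive_in v.
Proof.
move=> Va x /(is_V_memE _ Va)[d [w [da dw xw]]] z /xw.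
exact: V_subset_mono dw Va (or_introl da) z.
Qed.

Lemma V_ord_not a v : is_V a v -> ~ a \E v.
Proof.
move=> Va av; have oa := is_V_ord Va.
have [W VW] := V_total (ord_succ oa).
have dX : D0 3 (fun M r => exists l, l \E r 1 /\ (exists k, k \E r 1 /\ r 0 \E l)) by definability.
pose bad d := exists w, is_V d w /\ d \E w.
have dB : D0 4 (fun M r =>
    exists k l, maps_to (r 1) k l /\ (k = r 0 /\ r 0 \E l)) by definability.
case: (Va) => _ [f [Hf fav]].
have [X /= XE] := separation0 HM dB (fun _ => f) (succ a).
have [||b [/XE[ba [b' [w [bw [e bw']]]]] bm]] := @ord_least X.
- by move=> d /XE[/succE[/(ord_mem oa)|->]].
- by exists a; apply/XE; split; [apply/succE; right|exists a, v].
subst; have Vb := is_V_seq oa Hf bw.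
have /(is_V_memE _ Vb)[d [u [db Vd bu]]] := bw'.
have := bm d; case; [|move=> bd; exact: (no_two_cycle HM db bd)|move=> e; subst; exact: no_self db].
apply/XE; split.
  by apply/succE; apply: ord_le_trans (or_introl db) => //; apply/succE.
exists d, u; split; last by split=> //; exact: bu.
case: (Hf) => _ /(_ d) + _ => -[|u' [du' _]].
  by apply: ord_le_trans (or_introl db) => //; apply/succE.
by rewrite -(is_V_uniq (is_V_seq oa Hf du') Vd).
Qed.

Lemma V_ord_sub a v : is_V a v -> subset_in a v.
Proof.
move=> Va; have oa := is_V_ord Va; apply: contrapT => nav.
case: (Va) => _ [f [Hf fav]].
have dB : D0 4 (fun M r =>
    exists k l, maps_to (r 1) k l /\ (k = r 0 /\ ~ subset_in (r 0) l)) by definability.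
have [X /= XE] := separation0 HM dB (fun _ => f) (succ a).
have [||b [/XE[ba [b' [w [bw [e bw']]]]] bm]] := @ord_least X.
- by move=> d /XE[/succE[/(ord_mem oa)|->]].
- by exists a; apply/XE; split; [apply/succE; right|exists a, v].
subst; apply: bw' => d db; have Vb := is_V_seq oa Hf bw.
have da : ord_le d a by apply: ord_le_trans (or_introl db) => //; apply/succE.
case: (Hf) => _ /(_ d da) + _ => -[u [du _]].
apply/(is_V_memE _ Vb); exists d, u; split=> //; first exact: (is_V_seq oa Hf du).
apply: contrapT => ndu; case: (bm d).
- by apply/XE; split; [apply/succE|exists d, u].
- by move=> bd; exact: (no_two_cycle HM db bd).
- by move=> e; subst; exact: no_self db.
Qed.

(** The induction is over a Sigma_1^P property: a single witness [w] contains an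
    ordinal, the stage and the sequence that computes it. *)
Lemma V_cover x : exists a v, is_V a v /\ subset_in x v.
Proof.
have d : D0 3 (fun M r => exists k, k \E r 0 /\ exists l, l \E r 0 /\ exists m, m \E r 0 /\
    (ordinal_in k /\ V_sequence m k /\ maps_to m k l /\ subset_in (r 1) l)).
  by definability.
have [y IH|w /= [a [_ [v [_ [f [_ [oa [Hf [av xv]]]]]]]]]] :=
    sigma1_induction HM d (r := fun _ => x) _ x; last first.
  by exists a, v; split=> //; split=> //; exists f.
have dY : D0 3 (fun M r => exists k, k \E r 1 /\ exists l, l \E r 1 /\ exists m, m \E r 1 /\
    (ordinal_in k /\ V_sequence m k /\ maps_to m k l /\ subset_in (r 0) l)).
  by definability.
have [|Y YE] := collection0 HM dY (r := fun _ => x) (x := y); first exact: IH.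
have dO : D0 1 (fun M r => ordinal_in (r 0)) by definability.
have [O OE] := separation0 HM dO (fun _ => x) (union Y).
have oU : ordinal_in (union O) by apply: ord_union => a /OE[].
have [v Vv] := V_total (ord_succ oU).
suff yv : subset_in y v.
  have [f [Hf av]] := Vv.2.
  set a := succ (union O) in av Hf Vv.
  pose w := cup (upair HM a v) (sing f).
  exists w, a => /=; split; first by apply/cupE; left; apply/upairE; left.
  exists v; split; first by apply/cupE; left; apply/upairE; right.
  exists f; split; first by apply/cupE; right; apply/singE.
  by split=> //; case: Vv.
move=> z zy; have [w /= [wY [a [aw [u [_ [f [_ [oa [Hf [au zu]]]]]]]]]]] := YE _ zy.
have Vu : is_V a u by split=> //; exists f.
apply: V_sub_mem Vu Vv _ zu; apply/succE.
have aO : a \E O by apply/OE; split=> //; apply/unionE; exists w.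
case: (ord_total HM oa oU) => [?|->|Ua]; [by left|by right|].
by case: (@no_self (union O)); apply/unionE; exists a.
Qed.

Lemma rank_exists x : exists a, is_rank x a.
Proof.
have [b [v [Vb xv]]] := V_cover x; have ob := is_V_ord Vb.
case: (Vb) => _ [f [Hf fbv]].
have dB : D0 4 (fun M r =>
    exists k l, maps_to (r 1) k l /\ (k = r 0 /\ subset_in (r 2) l)) by definability.
have [X /= XE] := separation0 HM dB (scons f (fun _ => x)) (succ b).
have [||a [/XE[ab [a' [w [aw [e aw']]]]] am]] := @ord_least X.
- by move=> d /XE[/succE[/(ord_mem ob)|->]].
- by exists b; apply/XE; split; [apply/succE; right|exists b, v].
subst; have Va := is_V_seq ob Hf aw; have oa := is_V_ord Va.
exists a; split; first by exists w.
move=> d u da Vd xu; case: (am d).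
- have db : ord_le d b by apply: ord_le_trans (or_introl da) => //; apply/succE.
  apply/XE; split; [by apply/succE|exists d, u; split=> //].
  case: (Hf) => _ /(_ d db) + _ => -[u' [du' _]].
  by rewrite -(is_V_uniq (is_V_seq ob Hf du') Vd).
- by move=> ad; exact: (no_two_cycle HM da ad).
- by move=> e; subst; exact: no_self da.
Qed.

Lemma rank_ord x a : is_rank x a -> ordinal_in a.
Proof. by move=> [[v [/is_V_ord]]]. Qed.

Lemma rank_min x a b v : is_rank x a -> is_V b v -> subset_in x v -> ord_le a b.
Proof.
move=> Ra Vb xv; case: (ord_total HM (rank_ord Ra) (is_V_ord Vb)); [by left|by right|].
by move=> /(proj2 Ra)/(_ Vb).
Qed.

Lemma rank_lt x a b v : is_rank x a -> is_V b v -> x \E v -> a \E b.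
Proof.
move=> Ra Vb /(is_V_memE _ Vb)[d [w [db Vd xw]]].
by case: (rank_min Ra Vd xw) => [/(ord_trans (is_V_ord Vb) db)|->].
Qed.

Lemma rank_belowE b v x : is_V b v -> rank_below b x <-> x \E v.
Proof.
move=> Vb; split=> [[a [[[w [Va xw]] _] ab]]|xv]; first exact: (V_sub_mem Va Vb ab xw).
by have [a Ra] := rank_exists x; exists a; split=> //; exact: (rank_lt Ra Vb xv).
Qed.

(** Ordinals are their own rank, so rank-initial ranges contain the ranks of their
    elements. *)
Lemma is_rank_ord a : ordinal_in a -> is_rank a a.
Proof.
move=> oa; split.
  by have [v Vv] := V_total oa; exists v; split=> //; exact: V_ord_sub.
by move=> b v ba Vb av; case: (V_ord_not Vb); apply: av.
Qed.

Lemma rank_uniq x a b : is_rank x a -> is_rank x b -> a = b.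
Proof.
move=> Ra Rb; case: (Ra) (Rb) => -[v [Va xv]] _ [[w [Vb xw]] _].
case: (rank_min Ra Vb xw) => // ab; case: (rank_min Rb Va xv) => // ba.
by case: (no_two_cycle HM ab ba).
Qed.

(** Comparing ranks through the stages avoids computing them. *)
Lemma rank_leE x y : rank_le x y <->
  forall a v, is_V a v -> subset_in y v -> subset_in x v.
Proof.
split=> [[a [b [Ra Rb ab]]] c w Vc yw|H].
  have bc := rank_min Rb Vc yw; case: Ra => -[v [Va xv]] _ z /xv.
  exact: V_subset_mono Va Vc (ord_le_trans (is_V_ord Vc) bc ab) z.
have [a Ra] := rank_exists x; have [b Rb] := rank_exists y.
exists a, b; split=> //; case: (Rb) => -[w [Vb yw]] _.
by exact: rank_min Ra Vb (H _ _ Vb yw).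
Qed.

Lemma rank_le_mem x y : x \E y -> rank_le x y.
Proof. by move=> xy; apply/rank_leE => a v Va yv; apply: (V_transitive Va); exact: yv. Qed.

Lemma rank_le_sub x y : subset_in x y -> rank_le x y.
Proof. by move=> xy; apply/rank_leE => a v Va yv z /xy/yv. Qed.

Lemma rank_le_V a v x y : is_V a v -> rank_le x y -> y \E v -> x \E v.
Proof.
move=> Va /rank_leE H /(is_V_memE _ Va)[d [w [da dw yw]]].
exact: V_sub_mem dw Va da (H _ _ dw yw).
Qed.

Lemma rank_le_rank x a : is_rank x a -> rank_le x a /\ rank_le a x.
Proof.
move=> Ra; have oa := rank_ord Ra; have Raa := is_rank_ord oa.
by split; exists a, a; split=> //; right.
Qed.

(** The stages are transitive and closed under subsets, so this serves to bound any
    finite number of given sets. *)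
Lemma stage_exists x : exists a v, is_V a v /\ x \E v.
Proof.
have [a [v [Va xv]]] := V_cover x; have [w Vw] := V_total (ord_succ (is_V_ord Va)).
exists (succ a), w; split=> //; apply: V_sub_mem Va Vw _ xv.
by apply/succE; right.
Qed.

End Hierarchy.

Arguments V_subset_mono [M] HM [a b v w] Va Vb ab z zv : rename.
Arguments V_transitive [M] HM [a v] Va x xv z zx : rename.

(** * Rank under embeddings *)

Lemma rank_initial_closed (M N : structure) (HN : KPP N) (i : M -> N) :
  rank_initial i -> closed_embedding i.
Proof.
move=> [ei ri]; split=> // x n nx; apply: ri.
  exact: (rank_le_mem HN nx).
exact: (rank_le_sub HN nx).
Qed.

Lemma D0_is_V_at : D0 3 (fun M r =>
  [/\ ordinal_in (r 0), V_sequence (r 2) (r 0) & maps_to (r 2) (r 0) (r 1)]).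
Proof. by definability. Qed.

(* The source is only asked to have all its stages, so that the results apply to the
   range of an embedding as a structure. *)
Section ClosedRank.
Variables (A N : structure) (HN : KPP N) (i : A -> N).
Hypothesis ci : closed_embedding i.

Lemma closed_ordinal a : ordinal_in a <-> ordinal_in (i a).
Proof.
have d : D0 1 (fun M r => ordinal_in (r 0)) by definability.
exact: (D0_absolute ci d (fun _ => a)).
Qed.

Lemma closed_is_V a v : is_V a v -> is_V (i a) (i v).
Proof.
move=> [oa [f [Hf av]]].
have [//|? ? ?] := (D0_absolute ci D0_is_V_at (scons a (scons v (fun _ => f)))).1.
by split=> //; exists (i f).
Qed.

Hypothesis VA : forall b : A, ordinal_in b -> exists v, is_V b v.

Lemma closed_is_V_ex a v : ordinal_in a -> is_V (i a) v -> exists2 w, is_V a w & i w = v.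
Proof.
move=> oa Vv; have [w Vw] := VA oa; exists w => //.
exact: (is_V_uniq HN (closed_is_V Vw) Vv).
Qed.

Lemma closed_is_rank x a : is_rank x a -> is_rank (i x) (i a).
Proof.
move=> [[v [Va xv]] H]; split.
  by exists (i v); split; [exact: closed_is_V|exact/(closed_subset ci)].
move=> _ w /(closed_in ci)[b ba <-] Vw.
have ob : ordinal_in b by exact: ord_mem (is_V_ord Va) ba.
have [u Vu <-] := closed_is_V_ex ob Vw.
by move=> /(closed_subset ci); exact: H Vu.
Qed.

Lemma closed_rank_le x y : rank_le x y -> rank_le (i x) (i y).
Proof.
move=> [a [b [Ra Rb ab]]]; exists (i a), (i b); split; try exact: closed_is_rank.
by case: ab => [/(closed_mem ci)|->]; [left|right].
Qed.

End ClosedRank.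

Lemma closed_rank_initial (M N : structure) (HM : KPP M) (HN : KPP N) (i : M -> N) :
  closed_embedding i -> rank_initial i.
Proof.
move=> ci; split; first by case: ci.
move=> x n nx; have [a [v [Va xv]]] := stage_exists HM x.
have Via := closed_is_V ci Va.
have niv : n \E i v by apply: (rank_le_V HN Via nx); apply/(closed_mem ci).
by have [y _ <-] := closed_in ci niv; exists y.
Qed.

(** * Cuts and overspill *)

Section Cut.
Variables (S M : structure) (HM : KPP M) (e : S -> M).
Hypothesis cut : rank_cut e.

Let ce : closed_embedding e. Proof. by apply: rank_initial_closed => //; case: cut. Qed.

Lemma cut_rank_le x s : rank_le x (e s) -> range e x.
Proof. by case: cut => -[_ H] _; exact: H. Qed.

Lemma cut_rank s a : is_rank (e s) a -> range e a.
Proof. by move=> /(rank_le_rank HM)[_ /cut_rank_le]. Qed.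

Lemma cut_ord_lt a s : ordinal_in a -> ~ range e a -> ordinal_in (e s) -> e s \E a.
Proof.
move=> oa na os; case: (ord_total HM os oa) => //.
  by move=> E; case: na; exists s.
by move=> /(closed_in ce)[t _ E]; case: na; exists t.
Qed.

(** A least ordinal outside would contradict toplessness. *)
Lemma cut_succ s : ordinal_in (e s) -> range e (succ HM (e s)).
Proof.
move=> os; apply: contrapT => ns.
have [_ [_ H]] := cut; have [b [ob nb]] := H _ (ord_succ HM os) ns.
move=> /succE[/(closed_in ce)[t _ E]|E]; apply: nb; by [exists t|exists s].
Qed.

Lemma cut_stage a v : is_V a v -> range e a -> range e v.
Proof.
move=> Va [t _ E]; apply: (@cut_rank_le _ t); rewrite E.
apply/(rank_leE HM) => b w Vb aw.
have Ra := is_rank_ord HM (is_V_ord Va).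
apply: (V_subset_mono HM Va Vb); exact: (rank_min HM Ra Vb aw).
Qed.

Lemma cut_not_mem a v s : is_V a v -> ~ range e a -> e s \E v.
Proof.
move=> Va na; have [b Rb] := rank_exists HM (e s).
have [t _ E] := cut_rank Rb; have [[w [Vb sw]] _] := Rb.
have os : ordinal_in (e t) by rewrite E; exact: rank_ord Rb.
by apply: (V_sub_mem HM Vb Va) => //; rewrite -E; exact: cut_ord_lt (is_V_ord Va) na os.
Qed.

Lemma cut_upair s t : range e (upair HM (e s) (e t)).
Proof.
have [a Ra] := rank_exists HM (e s); have [b Rb] := rank_exists HM (e t).
have [[v [Va sv]] _] := Ra; have [[w [Vb tw]] _] := Rb.
have [a' _ ea] := cut_rank Ra; have [b' _ eb] := cut_rank Rb.
have [c [oc ac bc [c' _ ec]]] : exists c, [/\ ordinal_in c, ord_le a c, ord_le b c & range e c].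
  case: (ord_total HM (rank_ord Ra) (rank_ord Rb)) => [ab|->|ba].
  - by exists b; split=> //; [exact: rank_ord Rb|left|right|exists b'].
  - by exists b; split=> //; [exact: rank_ord Rb|right|right|exists b'].
  - by exists a; split=> //; [exact: rank_ord Ra|right|left|exists a'].
have [u Vu] := V_total HM oc; have [x Vx] := V_total HM (ord_succ HM oc).
have [y _ ey] : range e x.
  by apply: (cut_stage Vx); rewrite -ec; apply: cut_succ; rewrite ec.
have cs : c \E succ HM c by apply/succE; right.
suff : subset_in (upair HM (e s) (e t)) (e y) by move=> /(closed_sub ce)[z _ <-]; exists z.
rewrite ey => z /upairE[->|->]; apply: (V_sub_mem HM Vu Vx cs).
  by move=> z' /sv; apply: (V_subset_mono HM Va Vu ac).
by move=> z' /tw; apply: (V_subset_mono HM Vb Vu bc).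
Qed.

Lemma cut_opair s t : range e (opair HM (e s) (e t)).
Proof.
have [x _ ex] := cut_upair s s; have [y _ ey] := cut_upair s t.
by rewrite /opair /sing -ex -ey; exact: cut_upair.
Qed.

(** Toplessness excludes even the empty substructure: the ordinal 0 has no
    predecessor that could be outside. *)
Lemma cut_empty : range e (mempty HM).
Proof.
apply: contrapT => n0; have [_ [_ H]] := cut.
have [||b [_ _ /memptyE //]] := H (mempty HM) => //.
by split=> b /memptyE.
Qed.

Lemma cut_bound : exists a, ordinal_in a /\ ~ range e a.
Proof.
have [_ [[a [oa H]] _]] := cut; exists a; split=> // ra.
have [b [Rb ba]] := H _ ra; have E := rank_uniq HM Rb (is_rank_ord HM oa).
by subst; exact: (no_self HM ba).
Qed.

(** The least stage where [P] fails does not belong to the cut, and by toplessness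
    there is a smaller stage outside the cut; it still has [P], and it includes the
    cut. The hypothesis asks for sets of failures instead of a bounded definition
    because one application is to a Pi_1^P property, whose failures
    Sigma_1^P-Separation collects. *)
Lemma overspill (P : M -> Prop) :
  (forall x, exists y, forall u, u \E y <-> u \E x /\ ~ P u) ->
  (forall s, P (e s)) -> exists v, P v /\ forall s, e s \E v.
Proof.
move=> sepP PS; have [a [oa na]] := cut_bound.
have [v Va] := V_total HM oa; have [_ [f [Hf fa]]] := Va.
have [bad badE] := sepP (power HM v).
have dX : D0 3 (fun M r => exists k l, maps_to (r 1) k l /\ (k = r 0 /\ l \E r 2)) by definability.
have [X /= XE] := separation0 HM dX (scons f (fun _ => bad)) (succ HM a).
have [[x xX]|noX] := EM (exists x, x \E X); last first.
  exists v; split; last by move=> s; exact: cut_not_mem Va na.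
  apply: contrapT => nP; apply: noX; exists a; apply/XE; split.
    by apply/succE; right.
  by exists a, v; do 2 split=> //; apply/badE; split=> //; apply/powerE.
have [||b [/XE[ba [b' [w [bw [eb /badE[_ nPw]]]]]] bm]] := ord_least HM (x := X).
- by move=> d /XE[/succE[/(ord_mem oa)|->]].
- by exists x.
subst b'; have Vb := is_V_seq HM oa Hf bw; have ob := is_V_ord Vb.
have nb : ~ range e b.
  by move=> /(cut_stage Vb)[s _ E]; apply: nPw; rewrite -E.
have [_ [_ H]] := cut; have [c [oc nc cb]] := H _ ob nb.
have [u Vc] := V_total HM oc.
exists u; split; last by move=> s; exact: cut_not_mem Vc nc.
apply: contrapT => nPu.
have cX : c \E X.
  have ca : ord_le c a by apply: ord_le_trans (or_introl cb) => //; apply/succE.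
  apply/XE; split; first exact/succE.
  exists c, u; split; last first.
    split=> //; apply/badE; split=> //; apply/powerE.
    exact: (V_subset_mono HM Vc Va ca).
  case: (Hf) => _ /(_ c ca) + _ => -[u' [cu' _]].
  by rewrite -(is_V_uniq HM (is_V_seq HM oa Hf cu') Vc).
case: (bm _ cX) => [bc|E]; first exact: (no_two_cycle HM cb bc).
by subst; exact: (no_self HM cb).
Qed.

End Cut.

(** * Codes and their witnesses *)

Section Codes.
Variable M : structure.

Fixpoint is_num (n : nat) (k : M) : Prop :=
  if n is n'.+1 then exists l, l \E k /\ (is_num n' l /\ is_upair k l l)
  else forall l, l \E k -> l <> l.

(** What a code with a given tag [n] says is fixed by [supported]; in the first
    three cases [A] is an element or an index, in the last two a set of codes. *)
Definition is_code n (t i A : M) : Prop :=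
  exists x q, is_opair t x q /\ (is_num n x /\ is_opair q i A).

(** Tuples are represented by functions [e] on indices, and [e'] is [e] with the
    entry [m] at the new index [i]. *)
Definition extends (e i m e' : M) : Prop :=
  [/\ forall q, q \E e' -> q \E e \/ is_opair q i m, subset_in e e' & maps_to e' i m].

(** The elements that the range must contain once the entries of [e] are in it. *)
Definition near (e m : M) : Prop :=
  exists j x, maps_to e j x /\ (m \E x \/ subset_in m x).

Definition entry_mem (e i j : M) : Prop :=
  exists k x, maps_to e k x /\ (k = i /\ exists l y, maps_to e l y /\ (l = j /\ x \E y)).

Definition entry_nmem (e i j : M) : Prop :=
  exists k x, maps_to e k x /\ (k = i /\ exists l y, maps_to e l y /\ (l = j /\ ~ x \E y)).

Definition forth (u W e i A : M) : Prop :=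
  exists m, m \E u /\ exists e', e' \E u /\
    (extends e i m e' /\ forall t, t \E A -> maps_to W e' t).

Definition back (u W e i A : M) : Prop :=
  forall m, near e m -> exists e', e' \E u /\
    (extends e i m e' /\ exists t, t \E A /\ maps_to W e' t).

(** The clauses for the five tags. The last two only demand other pairs in [W], so
    [supported] is monotone in [W]; the set [u] bounds the existential quantifiers.
    *)
Definition supported (u W e t : M) : Prop :=
  exists i, i \E u /\ exists A, A \E u /\
  ((is_code 0 t i A /\ maps_to e i A) \/
  ((is_code 1 t i A /\ entry_mem e i A) \/
  ((is_code 2 t i A /\ entry_nmem e i A) \/
  ((is_code 3 t i A /\ forth u W e i A) \/
   (is_code 4 t i A /\ back u W e i A))))).

(** A post-fixed point of the clauses. Nothing demands that codes be well-founded,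
    nor that [W] be least or greatest: only that true codes can be unfolded, and
    that a code whose clause holds of true codes is true. *)
Definition witness_set (u W : M) : Prop :=
  forall e, e \E u -> forall t, t \E u -> maps_to W e t -> supported u W e t.

(** Collecting the data in one transitive set [u] makes this a Delta_0^P property,
    and [exists u, verifies u e t] the Sigma_1^P truth predicate for codes. *)
Definition verifies (u e t : M) : Prop :=
  transitive_in u /\ (e \E u /\ exists W, W \E u /\ (witness_set u W /\ maps_to W e t)).

End Codes.

Lemma D0_num n m i : i < n -> D0 n (fun M r => is_num m (r i)).
Proof.
by elim: m n i => [|m IH] n i lin /=; definability; apply: IH.
Qed.

Lemma D0_code m n i j k : i < n -> j < n -> k < n ->
  D0 n (fun M r => is_code m (r i) (r j) (r k)).
Proof. by move=> lin ljn lkn; rewrite /is_code; definability; apply: D0_num. Qed.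

Lemma D0_extends n i j k l : i < n -> j < n -> k < n -> l < n ->
  D0 n (fun M r => extends (r i) (r j) (r k) (r l)).
Proof. by move=> *; rewrite /extends; definability. Qed.

Lemma D0_near n i j : i < n -> j < n -> D0 n (fun M r => near (r i) (r j)).
Proof. by move=> *; rewrite /near; definability. Qed.

Lemma D0_entry_mem n i j k : i < n -> j < n -> k < n ->
  D0 n (fun M r => entry_mem (r i) (r j) (r k)).
Proof. by move=> *; rewrite /entry_mem; definability. Qed.

Lemma D0_entry_nmem n i j k : i < n -> j < n -> k < n ->
  D0 n (fun M r => entry_nmem (r i) (r j) (r k)).
Proof. by move=> *; rewrite /entry_nmem; definability. Qed.

Lemma D0_forth n i1 i2 i3 i4 i5 : i1 < n -> i2 < n -> i3 < n -> i4 < n -> i5 < n ->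
  D0 n (fun M r => forth (r i1) (r i2) (r i3) (r i4) (r i5)).
Proof. by move=> *; rewrite /forth; do 4 (definability; try apply: D0_extends). Qed.

Lemma D0_back n i1 i2 i3 i4 i5 : i1 < n -> i2 < n -> i3 < n -> i4 < n -> i5 < n ->
  D0 n (fun M r => back (r i1) (r i2) (r i3) (r i4) (r i5)).
Proof.
move=> *; pose B (M : structure) (u W e i A m : M) := exists e', e' \E u /\
    (extends e i m e' /\ exists t, t \E A /\ maps_to W e' t).
apply: (D0_ext (P' := fun M r => forall j x, maps_to (r i3) j x ->
  (forall m, m \E x -> B M (r i1) (r i2) (r i3) (r i4) (r i5) m) /\
  (forall m, subset_in m x -> B M (r i1) (r i2) (r i3) (r i4) (r i5) m))).
  move=> M r; split=> [H j x jx|H m [j [x [jx mx]]]].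
    by split=> m mx; apply: H; exists j, x; split=> //; [left|right].
  by have [H1 H2] := H _ _ jx; case: mx => mx; [exact: H1|exact: H2].
by rewrite /B; definability; apply: D0_extends.
Qed.

Ltac known_definable ::= first [ apply: D0_V_sequence | apply: D0_num | apply: D0_code
  | apply: D0_extends | apply: D0_near | apply: D0_entry_mem | apply: D0_entry_nmem
  | apply: D0_forth | apply: D0_back ].

Lemma D0_supported n i1 i2 i3 i4 : i1 < n -> i2 < n -> i3 < n -> i4 < n ->
  D0 n (fun M r => supported (r i1) (r i2) (r i3) (r i4)).
Proof. by move=> *; rewrite /supported; definability. Qed.

Lemma D0_witness_set n i j : i < n -> j < n ->
  D0 n (fun M r => witness_set (r i) (r j)).
Proof.
move=> *; rewrite /witness_set; do ! (apply: D0_all_in => //).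
by apply: D0_imp; [exact: D0_maps_to|exact: D0_supported].
Qed.

Lemma D0_verifies n i j k : i < n -> j < n -> k < n ->
  D0 n (fun M r => verifies (r i) (r j) (r k)).
Proof.
move=> *; rewrite /verifies; apply: D0_and; first by definability.
apply: D0_and; first by definability.
apply: D0_ex_in => //; apply: D0_and; last exact: D0_maps_to.
exact: D0_witness_set.
Qed.

Ltac known_definable ::= first [ apply: D0_V_sequence | apply: D0_num | apply: D0_code
  | apply: D0_extends | apply: D0_near | apply: D0_witness_set | apply: D0_verifies ].

(** * Truth of codes obeys its clauses *)

Section CodeTheory.
Variable M : structure.
Hypothesis HM : KPP M.
Implicit Types (x y z u v w p f a b c d g e t i A m W Y X : M).

(** Zermelo numerals, which are simpler to define by a bounded formula than von
    Neumann's. *)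
Definition num (n : nat) : M := iter n (sing HM) (mempty HM).

Definition code (n : nat) i A : M := opair HM (num n) (opair HM i A).

Definition extension e i m : M := cup HM e (sing HM (opair HM i m)).

Lemma numP n k : is_num n k <-> k = num n.
Proof.
elim: n k => [|n IH] k /=.
  split=> [H|-> l /(memptyE) //]; apply: (extensionality HM) => z.
  by split=> [/[dup] zk /H|/memptyE].
split=> [[l [lk [/IH -> /(upair_eq HM)]]] //|->].
exists (num n); split; first exact/singE.
by split; [exact/IH|exact: upairP].
Qed.

Lemma num_inj : injective num.
Proof.
elim=> [|n IH] [|k] //= E.
- by have /memptyE : num k \E mempty HM by rewrite E; apply/singE.
- by have /memptyE : num n \E mempty HM by rewrite -E; apply/singE.
- by congr _.+1; apply: IH; apply/(singE HM); rewrite -/(num _) -E; apply/singE.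
Qed.

Lemma is_codeE n t i A : is_code n t i A <-> t = code n i A.
Proof.
split=> [[x [q [/(opair_eq HM) -> [/numP -> /(opair_eq HM) ->]]]] //|->].
exists (num n), (opair HM i A); split; first exact: opairP.
by split; [exact/numP|exact: opairP].
Qed.

Lemma code_inj n n' i i' A A' : code n i A = code n' i' A' ->
  [/\ n = n', i = i' & A = A'].
Proof. by move=> /opair_inj[/num_inj -> /opair_inj[-> ->]]. Qed.

Lemma extendsE e i m e' : extends e i m e' <-> e' = extension e i m.
Proof.
split=> [[H1 H2 /(mapsE HM) H3]|->].
  apply: (extensionality HM) => z; rewrite cupE singE.
  by split=> [/H1[|/(opair_eq HM)]|[/H2|->]]; auto.
split=> [q /cupE[|/singE ->]|q qe|]; [by left| |by apply/cupE; left|].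
  by right; exact: opairP.
by apply/(mapsE HM)/cupE; right; apply/singE.
Qed.

Lemma in_trans_pair u p x y : transitive_in u -> is_opair p x y -> p \E u -> x \E u /\ y \E u.
Proof.
move=> tu [a [b [Ha Hb Hp]]] pu.
have au : a \E u by apply: tu pu _ _; apply/Hp; left.
have bu : b \E u by apply: tu pu _ _; apply/Hp; right.
by split; [apply: tu au _ _; apply/Ha; left|apply: tu bu _ _; apply/Hb; right].
Qed.

Lemma in_trans_maps u W x y : transitive_in u -> W \E u -> maps_to W x y -> x \E u /\ y \E u.
Proof. by move=> tu Wu [p [xy pW]]; apply: in_trans_pair xy _ => //; exact: tu Wu _ pW. Qed.

Lemma verifies_in u e t : verifies u e t -> e \E u /\ t \E u.
Proof. by move=> [tu [eu [W [Wu [_ m]]]]]; exact: in_trans_maps tu Wu m. Qed.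

Lemma in_trans_code u n i A : transitive_in u -> code n i A \E u -> i \E u /\ A \E u.
Proof.
move=> tu cu; have [_ qu] := in_trans_pair tu (opairP HM _ _) cu.
exact: in_trans_pair tu (opairP HM _ _) qu.
Qed.


(** Unfolding of a true code. The pairs in [W] are again verified by [u] itself, so
    a bound on [u] is kept under unfolding. *)
Lemma verifies_cases u e n i A : verifies u e (code n i A) ->
  exists W, [/\ (forall e' t', maps_to W e' t' -> verifies u e' t'),
    (n = 0 -> maps_to e i A), (n = 1 -> entry_mem e i A),
    n = 2 -> entry_nmem e i A & (n = 3 -> forth u W e i A) /\ (n = 4 -> back u W e i A)].
Proof.
move=> [tu [eu [W [Wu [cW mW]]]]]; have [_ cu] := in_trans_maps tu Wu mW.
have [i' [_ [A' [_ H]]]] := cW _ eu _ cu mW; exists W.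
have V e' t' : maps_to W e' t' -> verifies u e' t'.
  move=> m; split=> //; split; last by exists W.
  by have [] := in_trans_maps tu Wu m.
by move: H => [|[|[|[|]]]] [/is_codeE/code_inj [-> <- <-] ?]; split.
Qed.

Lemma supported_mono u u' W W' e t : subset_in u u' -> subset_in W W' ->
  supported u W e t -> supported u' W' e t.
Proof.
move=> uu WW [i [iu [A [Au H]]]]; exists i; split; first exact: uu.
exists A; split; first exact: uu.
have mW e' t' : maps_to W e' t' -> maps_to W' e' t'.
  by move=> [p [? ?]]; exists p; split=> //; exact: WW.
case: H => [|[|[|[|]]]] [H1 H2]; [by left|by right; left|by right; right; left| |].
  do 3 right; left; split=> //; case: H2 => m [mu [e' [eu [ex H2]]]].
  exists m; split; first exact: uu.
  by exists e'; split; [exact: uu|split=> // t' /H2/mW].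
do 4 right; split=> // m /H2 [e' [eu [ex [t' [t'A H3]]]]].
by exists e'; split; [exact: uu|split=> //; exists t'; split=> //; exact: mW].
Qed.


(** Post-fixed points are closed under unions. *)
Lemma join_witnesses Y : exists W0, forall u', transitive_in u' -> Y \E u' ->
  witness_set u' W0 /\ forall u e t, u \E Y -> verifies u e t -> maps_to W0 e t.
Proof.
have d : D0 3 (fun M r => exists k, k \E r 1 /\ exists l, l \E k /\
   (transitive_in k /\ (witness_set k l /\ r 0 \E l))).
  by definability.
have [W0 WE] := separation0 HM d (fun _ => Y) (union HM (union HM Y)).
exists W0 => u' tu' Yu'; split.
  move=> e _ t _ [p [pet /WE/= [_ [u [uY [W [Wu [tu [cW pW]]]]]]]]].
  have met : maps_to W e t by exists p.
  have [eu tu''] := in_trans_maps tu Wu met.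
  apply: supported_mono (cW _ eu _ tu'' met).
    by move=> z zu; exact: (tu' _ (tu' _ Yu' _ uY) _ zu).
  move=> q qW; apply/WE; split; last by exists u; split=> //; exists W.
  by apply/unionE; exists W; split=> //; apply/unionE; exists u.
move=> u e t uY [tu [eu [W [Wu [cW [p [pet pW]]]]]]].
exists p; split=> //; apply/WE; split; last by exists u; split=> //; exists W.
by apply/unionE; exists W; split=> //; apply/unionE; exists u.
Qed.

(** Given a set [Y] of witnesses, the pair [(e, t)] may be added to their union as
    soon as its clause holds there; [X] stands for further sets that the bound has
    to contain. *)
Lemma verifies_intro Y X e t :
  (forall u W, transitive_in u -> e \E u -> t \E u -> X \E u -> Y \E u ->
     (forall u0 e' t', u0 \E Y -> verifies u0 e' t' -> maps_to W e' t') ->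
     supported u W e t) ->
  exists u, verifies u e t.
Proof.
move=> H; have [W0 W0P] := join_witnesses Y.
pose W := cup HM W0 (sing HM (opair HM e t)).
have [a [u [Va /[dup]]]] := stage_exists HM (upair HM W (upair HM Y X)).
have tu := V_transitive HM Va.
move=> /tu sub1 pu; have Wu : W \E u by apply: sub1; apply/upairE; left.
have /tu sub2 : upair HM Y X \E u by apply: sub1; apply/upairE; right.
have Yu : Y \E u by apply: sub2; apply/upairE; left.
have Xu : X \E u by apply: sub2; apply/upairE; right.
have met : maps_to W e t by apply/(mapsE HM)/cupE; right; apply/singE.
have [eu tu'] := in_trans_maps tu Wu met.
have [cW0 mW0] := W0P _ tu Yu.
have sW : subset_in W0 W by move=> z; rewrite cupE; left.
exists u; split=> //; split=> //; exists W; split=> //; split=> //.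
move=> e' e'u t' t'u /(mapsE HM)/cupE [/(mapsE HM) m|/singE/opair_inj[-> ->]].
  by apply: supported_mono sW (cW0 _ e'u _ t'u m).
apply: H => // u0 e0 t0 u0Y /(mW0 _ _ _ u0Y)[p [? /sW ?]].
by exists p.
Qed.

Lemma verify_eq e i A : maps_to e i A -> exists u, verifies u e (code 0 i A).
Proof.
move=> m; apply: (@verifies_intro e e) => u W tu eu cu _ _ _.
have [iu Au] := in_trans_code tu cu.
by exists i; split=> //; exists A; split=> //; left; split=> //; apply/is_codeE.
Qed.

Lemma verify_mem e i A : entry_mem e i A -> exists u, verifies u e (code 1 i A).
Proof.
move=> m; apply: (@verifies_intro e e) => u W tu eu cu _ _ _.
have [iu Au] := in_trans_code tu cu.
by exists i; split=> //; exists A; split=> //; right; left; split=> //; apply/is_codeE.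
Qed.

Lemma verify_nmem e i A : entry_nmem e i A -> exists u, verifies u e (code 2 i A).
Proof.
move=> m; apply: (@verifies_intro e e) => u W tu eu cu _ _ _.
have [iu Au] := in_trans_code tu cu.
by exists i; split=> //; exists A; split=> //; do 2 right; left; split=> //; apply/is_codeE.
Qed.

Lemma verify_forth e i m A :
  (forall t, t \E A -> exists u, verifies u (extension e i m) t) ->
  exists u, verifies u e (code 3 i A).
Proof.
move=> H; set e' := extension e i m in H *.
have d : D0 3 (fun M r => verifies (r 1) (r 2) (r 0)) by apply: D0_verifies.
have [|Y /= YE] := collection0 HM d (r := fun _ => e') (x := A); first exact: H.
apply: (@verifies_intro Y (upair HM m e')) => u W tu eu cu /tu Xu Yu mW.
have [iu Au] := in_trans_code tu cu.
exists i; split=> //; exists A; split=> //; do 3 right; left.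
split; first exact/is_codeE.
exists m; split; first by apply: Xu; apply/upairE; left.
exists e'; split; first by apply: Xu; apply/upairE; right.
split; first exact/extendsE.
by move=> t /YE[u0 [u0Y /mW]]; exact.
Qed.

(** The elements near [e] form a set, so witnesses for them can be collected. *)
Lemma verify_back e i A :
  (forall m, near e m -> exists t, t \E A /\ exists u, verifies u (extension e i m) t) ->
  exists u, verifies u e (code 4 i A).
Proof.
move=> H; have [a [v [Va ev]]] := stage_exists HM e.
have dn : D0 2 (fun M r => near (r 1) (r 0)) by apply: D0_near.
have [X /= XE] := separation0 HM dn (fun _ => e) v.
have {}XE m : m \E X <-> near e m.
  rewrite XE; split=> [[]//|nm]; split=> //; case: nm => j [x [jx mx]].
  have [_ xv] := in_trans_maps (V_transitive HM Va) ev jx.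
  by case: mx => [/(V_transitive HM Va _ xv)|/(V_closed_sub HM Va xv)].
have d : D0 8 (fun M r => exists k, k \E r 1 /\ (extends (r 2) (r 3) (r 0) k /\
    exists l, l \E r 4 /\ verifies (r 1) k l)).
  by definability.
have [|Y /= YE] := collection0 HM d (r := scons e (scons i (fun _ => A))) (x := X).
  move=> m /XE /H[t [tA [u Qu]]]; exists u, (extension e i m).
  have [eu _] := verifies_in Qu; split=> //; split; first exact/extendsE.
  by exists t.
apply: (@verifies_intro Y e) => u W tu eu cu _ Yu mW.
have [iu Au] := in_trans_code tu cu.
exists i; split=> //; exists A; split=> //; do 4 right.
split; first exact/is_codeE.
move=> m /XE/YE [u0 [u0Y [e' [e'u [ex [t [tA Qt]]]]]]].
exists e'; split; first by exact: (tu _ (tu _ Yu _ u0Y) _ e'u).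
by split=> //; exists t; split=> //; exact: mW Qt.
Qed.

End CodeTheory.

(** * One step back or forth *)

Lemma sigma1_separation (M : structure) : Separation (SigmaP 1) M ->
  forall n P, D0 n P -> forall (r : nat -> M) x,
  exists y, forall u, u \E y <-> u \E x /\ exists w, P M (scons w (scons u r)).
Proof.
move=> SM n P [p [dp _ sp]] r x.
have [|y yP] := SM (Fex p) _ r x; first by exists p.
exists y => u; rewrite yP; split=> -[ux [w Pw]]; split=> //; exists w; exact/sp.
Qed.

Lemma cut_covered (S M : structure) (HM : KPP M) (e : S -> M) :
  rank_cut e -> exists v, forall s, e s \E v.
Proof.
move=> cut; have [a [oa na]] := cut_bound HM cut; have [v Va] := V_total HM oa.
by exists v => s; exact: (cut_not_mem HM cut s Va na).
Qed.

(** If two sets have the same trace on the cut, their parts below an element of the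
    cut are the same element of the cut. *)
Lemma meet_transfer (S M N : structure) (eM : S -> M) (eN : S -> N) (HM : KPP M) :
  closed_embedding eM -> closed_embedding eN ->
  forall a b, (forall s, eM s \E a <-> eN s \E b) ->
  forall s, exists c, (forall u, u \E eM c <-> u \E a /\ u \E eM s) /\
                      (forall u, u \E eN c <-> u \E b /\ u \E eN s).
Proof.
move=> cM cN a b ab s.
have d : D0 2 (fun M r => r 0 \E r 1) by definability.
have [c0 cE] := separation0 HM d (fun _ => a) (eM s).
have [c _ ec] : exists2 c, subset_in c s & eM c = c0 by apply: (closed_sub cM) => u /cE[].
subst c0; exists c; split=> u; first by rewrite cE /=; tauto.
split=> [/(closed_in cN)[y yc <-]|[ub /(closed_in cN)[y ys E]]].
  by have /(closed_mem cM)/cE [? /ab ?] := yc; split=> //; apply/(closed_mem cN)/(closed_mem cM).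
rewrite -E in ub *; apply/(closed_mem cN)/(closed_mem cM)/cE.
by split; [exact/(closed_mem cM)|exact/ab].
Qed.

Section BackAndForth.
Variables (S M N : structure) (eM : S -> M) (eN : S -> N).
Hypotheses (HM : KPP M) (HN : KPP N).
Hypothesis sigmaM : Separation (SigmaP 1) M.
Hypotheses (cutM : rank_cut eM) (cutN : rank_cut eN).
Hypothesis same_codes : Cod eM = Cod eN.

Let cM : closed_embedding eM.
Proof. by apply: rank_initial_closed => //; case: cutM. Qed.
Let cN : closed_embedding eN.
Proof. by apply: rank_initial_closed => //; case: cutN. Qed.

Lemma trace_MN (a : M) : exists b : N, forall s, eM s \E a <-> eN s \E b.
Proof.
have : Cod eM [set s | eM s \E a] by exists a.
by rewrite same_codes => -[b E]; exists b => s; have /= <- := congr1 (@^~ s) E.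
Qed.

Lemma trace_NM (b : N) : exists a : M, forall s, eM s \E a <-> eN s \E b.
Proof.
have : Cod eN [set s | eN s \E b] by exists b.
by rewrite -same_codes => -[a E]; exists a => s; have /= <- := congr1 (@^~ s) E.
Qed.

Lemma cut_num n : exists s, eM s = num HM n /\ eN s = num HN n.
Proof.
have [s _ es] : range eM (num HM n).
  elim: n => [|n [s _ es]]; first exact: cut_empty.
  by rewrite /= -/(num HM n) -es; exact: cut_upair.
exists s; split=> //; apply/numP.
have d : D0 1 (fun M r => is_num n (r 0)) by definability.
apply: (D0_absolute cN d (fun _ => s)).1.
by apply: (D0_absolute cM d (fun _ => s)).2; exact/numP.
Qed.

Lemma cut_code n i A : exists t, eM t = code HM n (eM i) (eM A) /\
  eN t = code HN n (eN i) (eN A).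
Proof.
have [k [kM kN]] := cut_num n.
have [q _ eq] := cut_opair HM cutM i A.
have [t _ et] := cut_opair HM cutM k q.
have et' : eM t = code HM n (eM i) (eM A) by rewrite et kM eq.
exists t; split=> //; apply/is_codeE.
have d : D0 3 (fun M r => is_code n (r 0) (r 1) (r 2)) by definability.
apply: (D0_absolute cN d (scons t (scons i (fun _ => A)))).1.
by apply: (D0_absolute cM d (scons t (scons i (fun _ => A)))).2; exact/is_codeE.
Qed.

Variable B : N.
Hypothesis B_transitive : transitive_in B.

(** Truth is only transported from [M] to [N]. The codes for non-membership make
    this enough to obtain an embedding. *)
Definition transfers (e : M) (e' : N) : Prop := forall t : S,
  (exists u, verifies u e (eM t)) -> exists u, u \E B /\ verifies u e' (eN t).

Lemma transfers_code e e' n i A : transfers e e' ->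
  (exists u, verifies u e (code HM n (eM i) (eM A))) ->
  exists u, u \E B /\ verifies u e' (code HN n (eN i) (eN A)).
Proof.
by move=> H; have [t [<- <-]] := cut_code n i A; exact: H.
Qed.

(** Let [a] be the set of codes true of the extension by [m], and [b] its
    counterpart in [N]. For [s] in the cut, the code demanding all of [a] below [s]
    is true of [e], which yields an extension in [N] that satisfies all of [b] below
    [s]; overspill replaces [s] by a set that includes the whole cut. *)
Lemma forth_step e e' i m : transfers e e' ->
  exists n, transfers (extension HM e (eM i) m) (extension HN e' (eN i) n).
Proof.
move=> T; set em := extension HM e (eM i) m.
have [v0 v0P] := cut_covered HM cutM.
have dv : D0 3 (fun M r => verifies (r 0) (r 2) (r 1)) by definability.
have [a /= aE] := sigma1_separation sigmaM dv (fun _ => em) v0.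
have [b ab] := trace_MN a.
pose P (v : N) := exists u, u \E B /\ exists n, n \E u /\ exists e'', e'' \E u /\
  (extends e' (eN i) n e'' /\ forall t, t \E b -> t \E v -> verifies u e'' t).
have dP : D0 5 (fun M r => ~ exists u, u \E r 1 /\ exists n, n \E u /\ exists e'', e'' \E u /\
  (extends (r 2) (r 3) n e'' /\ forall t, t \E r 4 -> t \E r 0 -> verifies u e'' t)).
  by definability.
have [||v [[u [uB [n [nu [e'' [e''u [/(extendsE HN) ex H]]]]]]] vS]] :=
    overspill HN cutN (P := P).
- by move=> x; have := separation0 HN dP (scons B (scons e' (scons (eN i) (fun _ => b)))) x.
- move=> s; have [c [cME cNE]] := meet_transfer HM cM cN ab s.
  have [|u [uB Qu]] := transfers_code (n := 3) (i := i) (A := c) T.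
    apply: (verify_forth (m := m)) => t /cME[/aE[_ [u Qu]] _].
    by exists u.
  have [W [QW _ _ _ [/(_ erefl) [n [nu [e'' [e''u [ex H]]]]] _]]] := verifies_cases Qu.
  exists u; split=> //; exists n; split=> //; exists e''; split=> //; split=> //.
  by move=> t tb ts; apply/QW/H/cNE.
exists n => t Qt; subst; exists u; split=> //; apply: H => //.
by apply/ab/aE; split.
Qed.

(** Let [b] be the set of codes not true in [N] of the extension by [n] with a
    bounded witness, and [a] its counterpart in [M]. For [s] in the cut, the code
    demanding some code of [a] below [s] from every near extension is not true of
    [e], as the extension by [n] would refute it in [N]. By overspill this holds for
    a set including the whole cut, and then some extension satisfies no code of [a].
    *)
Lemma back_step e e' i n : transfers e e' -> near e' n ->
  exists m, transfers (extension HM e (eM i) m) (extension HN e' (eN i) n).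
Proof.
move=> T nn; set en := extension HN e' (eN i) n.
have [v0 v0P] := cut_covered HN cutN.
have dv : D0 3 (fun M r => ~ exists u, u \E r 2 /\ verifies u (r 1) (r 0)) by definability.
have [b /= bE] := separation0 HN dv (scons en (fun _ => B)) v0.
have [a ab] := trace_NM b.
(* Overspill is applied to the negation of the Sigma_1^P property [exists u, R u v e i a]
   of [v]. *)
pose R (M : structure) (u v e i a : M) := exists c, c \E u /\
  ((forall x, x \E c -> x \E a /\ x \E v) /\
  ((forall x, x \E a -> x \E v -> x \E c) /\
   exists t, t \E u /\ (is_code 4 t i c /\ verifies u e t))).
pose P (v : M) := ~ exists u, R M u v e (eM i) a.
have dR : D0 5 (fun M r => R M (r 0) (r 1) (r 2) (r 3) (r 4)) by rewrite /R; definability.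
have [||v [Pv vS]] := overspill HM cutM (P := P).
- move=> x; have [y yE] := sigma1_separation sigmaM dR (scons e (scons (eM i) (fun _ => a))) x.
  by exists y => u; rewrite yE /P /= notK.
- move=> s [u [c0 [c0u [H1 [H2 [t [tu [/(is_codeE HM) -> Qu]]]]]]]].
  have [c [cME cNE]] := meet_transfer HM cM cN ab s.
  have E : c0 = eM c.
    by apply: (extensionality HM) => z; rewrite cME; split=> [/H1|[]] //; exact: H2.
  subst c0; have [|u' [u'B Qu']] := transfers_code (n := 4) (i := i) (A := c) T; first by exists u.
  have [W [QW _ _ _ [_ /(_ erefl)]]] := verifies_cases Qu'.
  move=> /(_ n nn) [e'' [e''u [/(extendsE HN) ex [t' [/cNE[/bE[_ t'b] _] t'W]]]]].
  by apply: t'b; exists u'; split=> //; rewrite /en -ex; exact: QW.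
have dc : D0 2 (fun M r => r 0 \E r 1) by definability.
have [c /= cE] := separation0 HM dc (fun _ => a) v.
apply: contrapT => nm; apply: Pv.
have [|u Qu] := verify_back (HM := HM) (e := e) (i := eM i) (A := c).
  move=> m _; apply: contrapT => nt; apply: nm; exists m => t Qt.
  have [tb|] := EM (eN t \E b).
    by case: nt; exists (eM t); split=> //; apply/cE; split=> //; exact/ab.
  by move=> ntb; apply: contrapT => nQ; apply: ntb; apply/bE.
exists u, c; have [_ cu] := verifies_in Qu; have tu := Qu.1.
split; first by have [] := in_trans_code tu cu.
split; first by move=> x /cE[].
split; first by move=> x xa xv; apply/cE.
by exists (code HM 4 (eM i) c); split=> //; split=> //; exact/is_codeE.
Qed.

End BackAndForth.

(** * The limit of the construction *)

Definition occurs (T : Type) (x : T) (l : seq T) : Prop :=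
  exists l1 l2, l = l1 ++ x :: l2.

Lemma occurs_cat (T : Type) (x : T) l l' : occurs x l -> occurs x (l' ++ l).
Proof. by move=> [l1 [l2 ->]]; exists (l' ++ l1), l2; rewrite catA. Qed.

Lemma occurs_cons (T : Type) (x y : T) l : occurs x (y :: l) <-> x = y \/ occurs x l.
Proof.
split=> [[[|z l1] [l2 /= [-> ->]]]|[->|[l1 [l2 ->]]]].
- by left.
- by right; exists l1, l2.
- by exists [::], l.
- by exists (y :: l1), l2.
Qed.

(* [hB] lists each element infinitely often, so that an element that becomes near
   late is still treated. *)
Section BackAndForthLimit.
Variables (A B : Type) (G : seq (A * B) -> Prop) (near : seq (A * B) -> B -> Prop).
Variables (hA : nat -> A) (hB : nat -> B).
Hypothesis hA_onto : forall a, exists k, hA k = a.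
Hypothesis hB_often : forall b k, exists2 k', k <= k' & hB k' = b.
Hypothesis forthG : forall l a, G l -> exists b, G ((a, b) :: l).
Hypothesis backG : forall l b, G l -> near l b -> exists a, G ((a, b) :: l).
Hypothesis near_cat : forall l l' b, near l b -> near (l' ++ l) b.

Lemma back_and_forth l0 : G l0 -> exists L : nat -> seq (A * B),
  [/\ L 0 = l0, forall k, G (L k),
      forall k k', k <= k' -> exists l, L k' = l ++ L k,
      forall a, exists k b, occurs (a, b) (L k)
    & forall k b, near (L k) b -> exists k' a, occurs (a, b) (L k')].
Proof.
move=> G0.
have step (k : nat) (l : {l | G l}) : exists l' : {l | G l},
    [/\ exists l2, sval l' = l2 ++ sval l, exists b, occurs (hA k, b) (sval l')
      & near (sval l) (hB k) -> exists a, occurs (a, hB k) (sval l')].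
  case: l => l Gl; have [b Gb] := forthG (hA k) Gl.
  have [nb|nnb] := EM (near l (hB k)); last first.
    exists (exist _ _ Gb); split=> //=; first by exists [:: (hA k, b)].
    by exists b; apply/occurs_cons; left.
  have [|a Ga] := backG Gb (b := hB k).
    by apply: (@near_cat l [:: (hA k, b)]).
  exists (exist _ _ Ga); split=> /=; first by exists [:: (a, hB k); (hA k, b)].
    by exists b; apply/occurs_cons; right; apply/occurs_cons; left.
  by move=> _; exists a; apply/occurs_cons; left.
pose F k := projT1 (choice (step k)); pose FP k := projT2 (choice (step k)).
pose L := fix L n := if n is n'.+1 then F n' (L n') else exist G l0 G0.
have Lcat k k' : k <= k' -> exists l, sval (L k') = l ++ sval (L k).
  elim: k' => [|k' IH]; first by rewrite leqn0 => /eqP ->; exists [::].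
  rewrite leq_eqVlt => /orP[/eqP ->|/IH [l El]]; first by exists [::].
  by have [[l2 /= El2] _ _] := FP k' (L k'); rewrite /= El2; exists (l2 ++ l); rewrite El catA.
exists (fun k => sval (L k)); split=> //.
- by move=> k; case: (L k).
- move=> a; have [k <-] := hA_onto a; exists k.+1.
  by have [_ Hb _] := FP k (L k).
- move=> k b nb; have [k' kk' E] := hB_often b k; exists k'.+1.
  have [_ _ Hb] := FP k' (L k'); rewrite -E; apply: Hb; rewrite E.
  by have [l ->] := Lcat _ _ kk'; apply: near_cat.
Qed.

End BackAndForthLimit.

(** The exponent of 2 takes each value infinitely often. *)
Lemma countable_enum (T : Type) (x0 : T) : countable [set: T] ->
  exists h : nat -> T, forall x k, exists2 k', k <= k' & h k' = x.
Proof.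
move=> /countable_injP[f /in2TT f_inj].
pose h n := if pselect (exists x, f x = n) is left H then sval (cid H) else x0.
have hf x : h (f x) = x.
  rewrite /h; case: pselect => [H|[]]; last by exists x.
  by apply: f_inj; case: cid.
exists (fun k => h (logn 2 k)) => x k; exists (2 ^ f x * k.*2.+1).
  rewrite -{1}[k]mul1n leq_mul ?expn_gt0 //.
  by apply: leqW; rewrite -addnn leq_addr.
rewrite lognM ?expn_gt0 // pfactorK // logn_coprime ?addn0 ?hf //.
by rewrite coprime2n /= odd_double.
Qed.

Section Environments.
Variables (M : structure) (HM : KPP M).

(** The most recent entry comes first in the list, so the index of an entry is the
    number of entries after it. *)
Fixpoint env (s : seq M) : M :=
  if s is x :: s' then extension HM (env s') (num HM (size s')) x else mempty HM.

Lemma env_maps s k x : maps_to (env s) k x <->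
  exists s1 s2, s = s1 ++ x :: s2 /\ k = num HM (size s2).
Proof.
elim: s => [|y s IH] /=.
  split=> [[p [_ /memptyE //]]|[s1 [s2 []]]]; by case: s1.
rewrite (mapsE HM) cupE -(mapsE HM) IH singE; split.
  move=> [[s1 [s2 [-> ->]]]|/opair_inj[-> ->]]; first by exists (y :: s1), s2.
  by exists [::], s.
move=> [[|z s1] [s2 /= [[-> ->] ->]]]; first by right.
by left; exists s1, s2.
Qed.

Lemma env_at s1 x s2 : maps_to (env (s1 ++ x :: s2)) (num HM (size s2)) x.
Proof. by apply/env_maps; exists s1, s2. Qed.

Lemma env_uniq s1 x s2 y : maps_to (env (s1 ++ x :: s2)) (num HM (size s2)) y -> y = x.
Proof.
move=> /env_maps[s1' [s2' [E /num_inj E2]]].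
have E1 : size s1 = size s1'.
  by move/(congr1 size): (E); rewrite !size_cat /= E2 => /addIn.
move/(congr1 (drop (size s1))): E.
by rewrite drop_size_cat // E1 drop_size_cat // => -[].
Qed.

Lemma env_near s m : near (env s) m <-> exists x, occurs x s /\ (m \E x \/ subset_in m x).
Proof.
split=> [[j [x [/env_maps[s1 [s2 [-> _]]] mx]]]|[x [[s1 [s2 ->]] mx]]].
  by exists x; split=> //; exists s1, s2.
by exists (num HM (size s2)), x; split=> //; exact: env_at.
Qed.

End Environments.

Section Embed.
Variables (S M N : structure) (eM : S -> M) (eN : S -> N).
Hypotheses (HM : KPP M) (HN : KPP N).
Hypothesis sigmaM : Separation (SigmaP 1) M.
Hypotheses (cutM : rank_cut eM) (cutN : rank_cut eN).
Hypothesis same_codes : Cod eM = Cod eN.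
Hypotheses (ctM : countable [set: M]) (ctN : countable [set: N]).
Variable B : N.
Hypothesis B_transitive : transitive_in B.

Local Notation good l :=
  (transfers eM eN B (env HM (map fst l)) (env HN (map snd l))).

(** Every extension of the tuple makes some code true, for instance the code for [p]
    not being a member of itself, and its witness is an element of the transitive
    set [B]. *)
Lemma good_bound l p : good l -> occurs p l -> p.2 \E B.
Proof.
move=> Gl [l1 [l2 E]]; have := Gl; rewrite E !map_cat /=.
set e := env HM _; set e' := env HN _ => T.
have [i [iM iN]] := cut_num HM HN cutM cutN (size l2).
have [|u [uB Qu]] := transfers_code (HM := HM) HN cutM cutN (n := 2) (i := i) (A := i) T.
  apply: verify_nmem; rewrite iM; exists (num HM (size l2)), p.1.
  have at_p : maps_to e (num HM (size l2)) p.1.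
    by have := env_at HM (map fst l1) p.1 (map fst l2); rewrite size_map.
  split=> //; split=> //; exists (num HM (size l2)), p.1; split=> //; split=> //.
  exact: no_self.
have [e'u _] := verifies_in Qu.
have at_p : maps_to e' (num HN (size l2)) p.2.
  by have := env_at HN (map snd l1) p.2 (map snd l2); rewrite size_map.
by have [] := in_trans_maps B_transitive (B_transitive uB e'u) at_p.
Qed.

Lemma good_mem l p q : good l -> occurs p l -> occurs q l ->
  p.1 \E q.1 <-> p.2 \E q.2.
Proof.
move=> T [l1 [l2 E]] [l1' [l2' E']].
have [i [iM iN]] := cut_num HM HN cutM cutN (size l2).
have [j [jM jN]] := cut_num HM HN cutM cutN (size l2').
have M1 : maps_to (env HM (map fst l)) (eM i) p.1.
  by rewrite E map_cat iM -(size_map fst); exact: env_at.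
have M2 : maps_to (env HM (map fst l)) (eM j) q.1.
  by rewrite E' map_cat jM -(size_map fst); exact: env_at.
have N1 y : maps_to (env HN (map snd l)) (eN i) y -> y = p.2.
  by rewrite E map_cat iN -(size_map snd); exact: env_uniq.
have N2 y : maps_to (env HN (map snd l)) (eN j) y -> y = q.2.
  by rewrite E' map_cat jN -(size_map snd); exact: env_uniq.
have [pq|npq] := EM (p.1 \E q.1).
  split=> // _.
  have [|u [_ Qu]] := transfers_code (HM := HM) HN cutM cutN (n := 1) (i := i) (A := j) T.
    by apply: verify_mem; exists (eM i), p.1; split=> //; split=> //; exists (eM j), q.1.
  have [_ [_ _ /(_ erefl) [k [x [+ [ek [k' [y [+ [ek' xy]]]]]]]] _ _]] := verifies_cases Qu.
  by subst k k' => /N1 <- /N2 <-.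
split=> // pq; exfalso.
have [|u [_ Qu]] := transfers_code (HM := HM) HN cutM cutN (n := 2) (i := i) (A := j) T.
  by apply: verify_nmem; exists (eM i), p.1; split=> //; split=> //; exists (eM j), q.1.
have [_ [_ _ _ /(_ erefl) [k [x [+ [ek [k' [y [+ [ek' xy]]]]]]]] _]] := verifies_cases Qu.
by subst k k' => /N1 e1 /N2 e2; apply: xy; rewrite e1 e2.
Qed.

(** Membership alone does not determine the images of the elements of [S], hence the
    codes for equality with such an element. *)
Lemma good_fixed l s n : good l -> occurs (eM s, n) l -> n = eN s.
Proof.
move=> T [l1 [l2 E]].
have [i [iM iN]] := cut_num HM HN cutM cutN (size l2).
have [|u [_ Qu]] := transfers_code (HM := HM) HN cutM cutN (n := 0) (i := i) (A := s) T.
  by apply: verify_eq; rewrite E map_cat iM -(size_map fst); exact: env_at.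
have [_ [_ /(_ erefl) + _ _ _]] := verifies_cases Qu.
by rewrite E map_cat iN -(size_map snd) => /env_uniq ->.
Qed.

(** There are no codes for equality of two entries. Members of an entry in [N] are
    themselves paired with members of the corresponding entry in [M], so by
    extensionality the limit is a function, and injective. *)
Lemma embedding_of_transfers (x : M) (y : N) :
  transfers eM eN B (env HM [:: x]) (env HN [:: y]) ->
  exists i : M -> N, [/\ rank_initial i, forall s, i (eM s) = eN s, i x = y
    & forall m, i m \E B].
Proof.
move=> T0; have [hM hMP] := countable_enum x ctM; have [hN hNP] := countable_enum y ctN.
have [||||L [L0 LG Lcat LM LN]] := back_and_forth (G := fun l => good l)
    (near := fun l => near (env HN (map snd l))) (hA := hM) (hB := hN)
    _ hNP _ _ _ (l0 := [:: (x, y)]) T0.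
- by move=> a; have [k _ ?] := hMP a 0; exists k.
- move=> l a T; have [i [iM iN]] := cut_num HM HN cutM cutN (size l).
  have [n Tn] := forth_step HM HN sigmaM cutM cutN same_codes i a T.
  by exists n; rewrite /= !size_map -iM -iN.
- move=> l b T nb; have [i [iM iN]] := cut_num HM HN cutM cutN (size l).
  have [m Tm] := back_step HM HN sigmaM cutM cutN same_codes i T nb.
  by exists m; rewrite /= !size_map -iM -iN.
- move=> l l' b /env_near[z [oz bz]]; apply/env_near; exists z; split=> //.
  by rewrite map_cat; exact: occurs_cat.
pose R m n := exists k, occurs (m, n) (L k).
have join m n m' n' : R m n -> R m' n' -> exists k, occurs (m, n) (L k) /\ occurs (m', n') (L k).
  move=> [k ok] [k' ok']; exists (maxn k k').
  have [l E] := Lcat _ _ (leq_maxl k k'); have [l' E'] := Lcat _ _ (leq_maxr k k').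
  by split; [rewrite E|rewrite E']; exact: occurs_cat.
have Rmem m n m' n' : R m n -> R m' n' -> m \E m' <-> n \E n'.
  by move=> r /(join _ _ _ _ r)[k [o o']]; exact: good_mem (LG k) o o'.
have Rback m n z : R m n -> z \E n \/ subset_in z n -> exists m', R m' z.
  move=> [k [l1 [l2 E]]] zn; have [|k' [m' o]] := LN k z; last by exists m', k'.
  apply/env_near; exists n; split=> //.
  by rewrite E map_cat; exists (map snd l1), (map snd l2).
have Rfun m n n' : R m n -> R m n' -> n = n'.
  move=> r r'; apply: (extensionality HN) => z; split=> zn.
    have [m' r''] := Rback _ _ _ r (or_introl zn).
    by apply/(Rmem _ _ _ _ r'' r'); apply/(Rmem _ _ _ _ r'' r).
  have [m' r''] := Rback _ _ _ r' (or_introl zn).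
  by apply/(Rmem _ _ _ _ r'' r); apply/(Rmem _ _ _ _ r'' r').
have [i iR] : exists i : M -> N, forall m, R m (i m).
  have tot m : exists n, R m n by have [k [n ?]] := LM m; exists n, k.
  by exists (fun m => sval (cid (tot m))) => m; case: cid.
have im m n : R m n -> i m = n by move=> /(Rfun _ _ _ (iR m)).
have ci : closed_embedding i.
  split; [split|..].
  - move=> m m' E; apply: (extensionality HM) => z.
    by rewrite (Rmem _ _ _ _ (iR z) (iR m)) (Rmem _ _ _ _ (iR z) (iR m')) E.
  - by move=> m m'; exact: Rmem.
  - move=> m n nm; have [m' /im <-] := Rback _ _ _ (iR m) (or_introl nm).
    by exists m'.
  - move=> m n nm; have [m' /im <-] := Rback _ _ _ (iR m) (or_intror nm).
    by exists m'.
exists i; split.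
- exact: closed_rank_initial.
- by move=> s; have [k o] := iR (eM s); exact: good_fixed (LG k) o.
- by apply: im; exists 0; rewrite L0; exists [::], [::].
- by move=> m; have [k o] := iR m; exact: (good_bound (LG k) o).
Qed.

End Embed.

(** * The tree of embeddings *)

(** The tuple with the single entry [m], described by a bounded formula. *)
Definition is_env1 (M : structure) (e m : M) : Prop :=
  (exists k x, maps_to e k x /\ (is_num 0 k /\ x = m)) /\
  forall q, q \E e -> exists k x, is_opair q k x /\ (is_num 0 k /\ x = m).

Lemma is_env1E (M : structure) (HM : KPP M) (e m : M) : is_env1 e m <-> e = env HM [:: m].
Proof.
split=> [[[k [x [/(mapsE HM) H [/(numP HM) ek ex]]]] H']|->].
  subst; apply: (extensionality HM) => q; rewrite cupE singE; split.
    by move=> /H'[k [x [/(opair_eq HM) -> [/(numP HM) -> ->]]]]; right.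
  by move=> [/memptyE//|->].
split.
  exists (num HM 0), m; split; first exact: (env_at HM [::] m [::]).
  by split=> //; exact/numP.
move=> q /cupE[/memptyE//|/singE ->]; exists (num HM 0), m.
by split; [exact: opairP|split=> //; exact/numP].
Qed.

Lemma D0_env1 n i j : i < n -> j < n -> D0 n (fun M r => is_env1 (r i) (r j)).
Proof. by move=> *; rewrite /is_env1; definability. Qed.

Section ClosedCodes.
Variables (M N : structure) (HM : KPP M) (HN : KPP N) (i : M -> N).
Hypothesis ci : closed_embedding i.

Lemma closed_env1 x : i (env HM [:: x]) = env HN [:: i x].
Proof.
have d : D0 2 (fun M r => is_env1 (r 0) (r 1)) by apply: D0_env1.
apply/is_env1E; apply: (D0_absolute ci d (scons _ (fun _ => x))).1.
exact/is_env1E.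
Qed.

Lemma closed_verifies u e t : verifies u e t -> verifies (i u) (i e) (i t).
Proof.
have d : D0 3 (fun M r => verifies (r 0) (r 1) (r 2)) by definability.
exact: (D0_absolute ci d (scons u (scons e (fun _ => t)))).1.
Qed.

Lemma closed_transitive x : transitive_in x -> transitive_in (i x).
Proof.
have d : D0 1 (fun M r => transitive_in (r 0)) by definability.
exact: (D0_absolute ci d (fun _ => x)).1.
Qed.

End ClosedCodes.

(** [embedding_of_transfers] prescribes the image of one element; coding a list by
    iterated pairs, which closed embeddings preserve, prescribes finitely many. *)
Lemma tuple_code (M N : structure) (HM : KPP M) (HN : KPP N) (l : seq M) :
  exists x : M, forall j j' : M -> N, closed_embedding j -> closed_embedding j' ->
    j x = j' x -> forall y, occurs y l -> j y = j' y.
Proof.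
elim: l => [|z l [x IH]]; first by exists (mempty HM) => j j' _ _ _ y [[|? ?]] [].
exists (opair HM z x) => j j' cj cj' E.
have d : D0 3 (fun M r => is_opair (r 0) (r 1) (r 2)) by definability.
have P (k : M -> N) : closed_embedding k -> is_opair (k (opair HM z x)) (k z) (k x).
  move=> ck; apply: (D0_absolute ck d (scons _ (scons z (fun _ => x)))).1.
  exact: opairP.
have := P j cj; rewrite E => /(is_opair_inj HN (P j' cj')) [Ez /esym Ex].
by move=> y /occurs_cons[->|] //; exact: IH.
Qed.

Section Tree.
Variables (S M N : structure) (eM : S -> M) (eN : S -> N).
Hypotheses (HM : KPP M) (HN : KPP N).
Hypothesis sigmaM : Separation (SigmaP 1) M.
Hypotheses (cutM : rank_cut eM) (cutN : rank_cut eN).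
Hypothesis same_codes : Cod eM = Cod eN.
Hypotheses (ctM : countable [set: M]) (ctN : countable [set: N]).

Definition fixes (i : M -> N) : Prop := forall s, i (eM s) = eN s.

(** The second component of [p] is a stage containing witnesses for all codes in [S]
    that are true of a tuple of the elements of [l], so its image can serve as the
    bound in place of the one for [i]. *)
Lemma shrink (i : M -> N) (l : seq M) : rank_initial i -> fixes i ->
  exists p : (M -> N) * M, [/\ rank_initial p.1, fixes p.1,
    forall y, occurs y l -> p.1 y = i y, transitive_in (i p.2)
    & forall m, p.1 m \E i p.2].
Proof.
move=> ri fi; have ci := rank_initial_closed HN ri.
have [x xP] := tuple_code HM HN l.
have [v0 v0P] := cut_covered HM cutM.
have dv : D0 3 (fun M r => verifies (r 0) (r 2) (r 1)) by definability.
have [a /= aE] := sigma1_separation sigmaM dv (fun _ => env HM [:: x]) v0.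
have dc : D0 3 (fun M r => verifies (r 1) (r 2) (r 0)) by definability.
have [|Y /= YE] := collection0 HM dc (r := fun _ => env HM [:: x]) (x := a).
  by move=> t /aE[_].
have [g [z [Vz Yz]]] := stage_exists HM Y; have tz := V_transitive HM Vz.
have tiz := closed_transitive ci tz.
have T : transfers eM eN (i z) (env HM [:: x]) (env HN [:: i x]).
  move=> t Qt; have [|u [uY Qu]] := YE (eM t); first by apply/aE.
  exists (i u); split; first by apply/(closed_mem ci); exact: tz Yz _ uY.
  by rewrite -(closed_env1 HM HN ci) -fi; exact: closed_verifies.
have [j [rj fj jx jB]] := embedding_of_transfers sigmaM cutM cutN same_codes ctM ctN tiz T.
exists (j, z); split=> //= y.
by apply: xP => //; exact: rank_initial_closed.
Qed.

Variables (v : N) (m0 : M) (n0 : N).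
Hypothesis v_transitive : transitive_in v.

Definition admissible (i : M -> N) : Prop :=
  [/\ rank_initial i, fixes i, i m0 = n0 & forall m, i m \E v].

Variable i0 : M -> N.
Hypothesis i0_adm : admissible i0.

(** At level [k], [st g k] consists of an embedding and the list of elements on
    which all later embeddings agree with it. The list receives the next element of
    [M] and, to make the limit rank-initial, the preimage of the next element of [N]
    under the new embedding, if there is one. *)
Lemma embedding_tree : exists I : (nat -> bool) -> M -> N,
  (forall g, admissible (I g)) /\
  (forall g g', lt_lex g g' -> exists c : N, [/\ range (I g') c, transitive_in c
     & forall m, I g m \E c]).
Proof.
have [hM hMP] := countable_enum m0 ctM; have [hN hNP] := countable_enum n0 ctN.
pose shrinks (st : (M -> N) * seq M) (p : (M -> N) * M) :=
  rank_initial st.1 -> fixes st.1 -> [/\ rank_initial p.1, fixes p.1,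
    forall y, occurs y st.2 -> p.1 y = st.1 y, transitive_in (st.1 p.2)
    & forall m, p.1 m \E st.1 p.2].
have ex_shrinks st : exists p, shrinks st p.
  case: st => i l; have [[ri fi]|H] := EM (rank_initial i /\ fixes i); last first.
    by exists (i, m0) => ri fi; case: H.
  by have [p pP] := shrink l ri fi; exists p.
have [sp spP] := choice ex_shrinks.
pose pre (i : M -> N) n := if pselect (exists m, i m = n) is left H then sval (cid H) else m0.
have preP i n : (exists m, i m = n) -> i (pre i n) = n.
  by move=> H; rewrite /pre; case: pselect => // H'; case: cid.
pose st (g : nat -> bool) := fix st k : (M -> N) * seq M := if k is k'.+1 then
    let s := st k' in let j := if g k' then s.1 else (sp s).1 in
    (j, [:: (if g k' then (sp s).2 else m0), hM k', pre j (hN k') & s.2])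
  else (i0, [:: m0]).
pose em g k := (st g k).1; pose li g k := (st g k).2.
have em_spec g k : rank_initial (em g k) /\ fixes (em g k).
  elim: k => [|k [ri fi]]; first by case: i0_adm.
  rewrite /em /=; case: ifP => // _.
  by have [] := spP (st g k) ri fi.
have em_step g k y : occurs y (li g k) -> em g k.+1 y = em g k y.
  move=> o; rewrite /em /=; case: ifP => // _.
  by have [ri fi] := em_spec g k; have [_ _ H _ _] := spP (st g k) ri fi; exact: H.
have li_step g k y : occurs y (li g k) -> occurs y (li g k.+1).
  move=> o; exact: (@occurs_cat _ _ _ [:: _; _; _]).
have li_mono g k k' y : k <= k' -> occurs y (li g k) -> occurs y (li g k').
  move=> /leP; elim=> // k'' _ IH /IH; exact: li_step.
have em_stable g k k' y : k <= k' -> occurs y (li g k) -> em g k' y = em g k y.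
  move=> /leP kk o; elim: kk => // k'' /leP kk <-; apply: em_step.
  exact: li_mono kk o.
have li_all g y : exists K, occurs y (li g K).
  have [k _ <-] := hMP y 0; exists k.+1; rewrite /li /=.
  by apply/occurs_cons; right; apply/occurs_cons; left.
pose I g y := em g (sval (cid (li_all g y))) y.
have IE g k y : occurs y (li g k) -> I g y = em g k y.
  move=> o; rewrite /I; case: cid => K /= oK.
  by case: (leqP k K) => [kK|/ltnW kK]; [|symmetry]; apply: em_stable.
have I2 g y y' : exists k, [/\ occurs y (li g k), I g y = em g k y & I g y' = em g k y'].
  have [K oK] := li_all g y; have [K' oK'] := li_all g y'.
  have o := li_mono _ _ _ _ (leq_maxl K K') oK.
  have o' := li_mono _ _ _ _ (leq_maxr K K') oK'.
  by exists (maxn K K'); split=> //; apply: IE.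
have em_v g k m : em g k m \E v.
  elim: k m => [|k IH] m; first by case: i0_adm.
  rewrite /em /=; case: ifP => [_|_]; first exact: IH.
  have [ri fi] := em_spec g k; have [_ _ _ _ H] := spP (st g k) ri fi.
  exact: v_transitive (IH _) _ (H m).
have I_adm g : admissible (I g).
  split.
  - split; [split|].
    + move=> x y; have [k [_ -> ->]] := I2 g x y.
      by have [ri _] := em_spec g k; exact: (closed_inj (rank_initial_closed HN ri)).
    + move=> x y; have [k [_ -> ->]] := I2 g x y.
      by have [ri _] := em_spec g k; exact: (closed_mem (rank_initial_closed HN ri)).
    + move=> m n rn; have [K oK] := li_all g m; have [k Kk hk] := hNP n K.
      have o := li_mono _ _ _ _ (leqW Kk) oK.
      have [[_ /(_ m n) H] _] := em_spec g k.+1; rewrite -(IE _ _ _ o) in H.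
      have [m' _ E] := H rn; exists (pre (em g k.+1) n) => //.
      rewrite (IE _ k.+1); first by apply: preP; exists m'.
      rewrite /li /=; do 2 (apply/occurs_cons; right).
      by apply/occurs_cons; left; rewrite hk.
  - by move=> s; have [k [_ -> _]] := I2 g (eM s) (eM s); have [_] := em_spec g k.
  - by rewrite (IE _ 0); [case: i0_adm|exists [::], [::]].
  - by move=> m; have [k [_ -> _]] := I2 g m m.
exists I; split=> // g g' [n [gg gn gn']].
have st_eq k : k <= n -> st g k = st g' k.
  by elim: k => // k IH kn; rewrite /= IH ?gg // ltnW.
have [ri fi] := em_spec g n; have [_ _ _ tc cB] := spP (st g n) ri fi.
set c := (st g n).1 _ in tc cB; exists c; split=> //.
  exists (sp (st g n)).2 => //; rewrite (IE _ n.+1).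
    by rewrite /em /= gn' -st_eq.
  by rewrite /li /= gn' -st_eq //; apply/occurs_cons; left.
have em_c k m : n < k -> em g k m \E c.
  elim: k m => // k IH m; rewrite ltnS leq_eqVlt => /orP[/eqP E|nk].
    by subst k; rewrite /em /= gn; exact: cB.
  rewrite /em /=; case: ifP => [_|_]; first exact: IH.
  have [ri' fi'] := em_spec g k; have [_ _ _ _ H] := spP (st g k) ri' fi'.
  exact: tc (IH _ nk) _ (H m).
move=> m; have [K oK] := li_all g m.
rewrite (IE _ (maxn K n.+1)); last exact: li_mono (leq_maxl _ _) oK.
by apply: em_c; exact: leq_maxr.
Qed.

End Tree.

(** * Comparing ranges *)

Lemma closed_sval (M N : structure) (HN : KPP N) (j : M -> N) : rank_initial j ->
  closed_embedding (fun x : substructure (range j) => sval x).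
Proof.
move=> rj; have cj := rank_initial_closed HN rj.
split; first by split=> // -[x hx] [y hy] /= E; exact: eq_exist.
  move=> [x [m _ e]] n /=; subst x => /(closed_in cj)[y _ yn].
  have rn : range j n by exists y.
  by exists (exist _ n rn).
move=> [x [m _ e]] n /=; subst x => /(closed_sub cj)[y _ yn].
have rn : range j n by exists y.
by exists (exist _ n rn).
Qed.

Lemma range_V_total (M N : structure) (HM : KPP M) (j : M -> N) : embedding j ->
  forall b : substructure (range j), ordinal_in b -> exists v, is_V b v.
Proof.
move=> [injj memj].
pose k (m : M) : substructure (range j) := exist _ (j m) (ex_intro2 _ _ m I erefl).
have surk y : exists m, k m = y by case: y => x [m hm e]; exists m; exact: eq_exist.
have ck : closed_embedding k.
  split; first by split=> [m m' [/injj]|m m'] //; exact: memj.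
    by move=> x n _; have [m <-] := surk n; exists m.
  by move=> x n _; have [m <-] := surk n; exists m.
move=> b; have [m <-] := surk b => /(closed_ordinal ck)/(V_total HM)[v Vv].
by exists (k v); exact: closed_is_V.
Qed.

(** Ranks computed in the range of [j] are those computed in [N], as the range is
    closed and contains all its stages. *)
Lemma lt_rank_of_bound (M N : structure) (HM : KPP M) (HN : KPP N) (i j : M -> N) (c : N) :
  rank_initial i -> rank_initial j -> range j c -> (forall m, i m \E c) -> lt_rank i j.
Proof.
move=> ri rj [z _ ez] ic; subst c; have cj := rank_initial_closed HN rj.
have ij : range i `<=` range j.
  by move=> _ [m _ <-]; have [y _ <-] := closed_in cj (ic m); exists y.
split; first split=> //.
  move=> /(_ (j z)) []; first by exists z.
  by move=> m _ E; apply: (@no_self N HN (j z)); rewrite -{1}E.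
exists ij; split; first split.
- by move=> [x hx] [y hy] [E]; exact: eq_exist.
- by [].
- move=> [x hx] n rn.
  have := closed_rank_le HN (closed_sval HN rj) (range_V_total HM rj.1) rn.
  rewrite /= => le; have rin : range i (sval n).
    have [m _ e] := hx; rewrite -e in le; by case: ri => _ /(_ m); apply.
  by exists (exist _ (sval n) rin) => //; case: n {rn le} rin => n hn rin; exact: eq_exist.
Qed.

(** The rank of an element of the larger range outside the smaller one is an ordinal
    with the same property. *)
Lemma smaller_ordinal_outside (M N : structure) (HN : KPP N) (i j : M -> N) (b : N) :
  rank_initial i -> rank_initial j -> range i `<` range j ->
  ordinal_in b -> ~ range j b -> exists b', [/\ ordinal_in b', ~ range i b' & b' \E b].
Proof.
move=> ri rj [_ /existsNP[n /not_implyP[[m _ <-] nim]]] ob nb.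
have [a Ra] := rank_exists HN (j m); have [le1 le2] := rank_le_rank HN Ra.
have oa := rank_ord Ra; exists a; split=> //.
  by move=> [x _ E]; apply: nim; case: ri => _ /(_ x); apply; rewrite E.
have [y _ E] : range j a by case: rj => _ /(_ m); apply.
case: (ord_total HN oa ob) => // [e|ba]; first by case: nb; subst b; exists y.
case: nb; case: rj => _ /(_ y); apply.
by rewrite E; exact: rank_le_mem.
Qed.

Lemma lt_lex_total (g h : nat -> bool) : g <> h -> lt_lex g h \/ lt_lex h g.
Proof.
move=> ne; have [n nn] : exists n, g n != h n.
  apply: contrapT => H; apply: ne; apply/funext => n.
  by apply/eqP/negPn/negP => ?; apply: H; exists n.
have := ex_minnP (ex_intro (fun n => g n != h n) n nn) => -[k nk kmin].
have eqk l : l < k -> g l = h l.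
  by move=> lk; apply/eqP/negPn/negP => /kmin; rewrite leqNgt lk.
case gk : (g k) nk; case hk : (h k) => // _; [right|left]; exists k; split=> // l /eqk //.
Qed.

Lemma uncountable_cantor (T : Type) (f : (nat -> bool) -> T) :
  injective f -> countable [set: T] -> False.
Proof.
move=> fi /countable_injP[h /in2TT hi].
pose D n := ~~ `[< exists g, h (f g) = n /\ g n >].
have : D (h (f D)) = ~~ D (h (f D)).
  rewrite {1}/D; congr (~~ _); apply/asboolP/idP => [[g [/hi/fi -> //]]|H].
  by exists D.
by case: (D _).
Qed.

(** * The equivalence *)

Section Equivalence.
Variables (M N S : structure) (eM : S -> M) (eN : S -> N).
Hypotheses (HM : KPP M) (HN : KPP N).
Hypotheses (cutM : rank_cut eM) (cutN : rank_cut eN).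
Variables (m0 : M) (n0 beta : N).

(** A set of [N] need not be in the range, but its part inside the image of a set
    including [S] is. *)
Lemma embedding_same_codes i : rank_initial_over eM eN m0 n0 beta i -> Cod eM = Cod eN.
Proof.
move=> [ri fi _ _]; have ci := rank_initial_closed HN ri.
apply/seteqP; split=> A [c ->].
  exists (i c); apply/seteqP; split=> x /=; rewrite -fi; first by move/(closed_mem ci).
  by move=> ?; apply/(closed_mem ci).
have [v vP] := cut_covered HM cutM.
have d : D0 2 (fun M r => r 0 \E r 1) by definability.
have [c0 c0E] := separation0 HN d (fun _ => c) (i v).
have [b _ eb] : exists2 b, subset_in b v & i b = c0 by apply: (closed_sub ci) => u /c0E[].
exists b; apply/seteqP; split=> x /=;
  rewrite (propext (closed_mem ci (eM x) b)) eb (propext (c0E _)) fi.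
  by move=> xc; split=> //; rewrite -fi; exact/(closed_mem ci).
by case.
Qed.

Lemma embedding_sigma i (s : S) (delta : formula) : ordinal_in beta ->
  rank_initial_over eM eN m0 n0 beta i -> Delta0P delta ->
  (exists x : M, sat (scons x (scons m0 (fun _ => eM s))) delta) ->
  exists x v : N, [/\ is_V beta v, x \E v
    & sat (scons x (scons n0 (fun _ => eN s))) delta].
Proof.
move=> ob [ri fi i0 ib] dd [x]; have ci := rank_initial_closed HN ri.
move=> /(sat_absolute ci dd); rewrite !comp_scons i0.
have -> : i \o (fun _ : nat => eM s) = (fun _ => eN s) by apply/funext => k /=; exact: fi.
have [v Vv] := V_total HN ob; exists (i x), v; split=> //.
by apply/(rank_belowE HN _ Vv)/ib; exists x.
Qed.

(** A single bounded formula is needed, with the code as its parameter in [S]. *)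
Lemma transfers_of_sigma (v : N) : is_V beta v ->
  (forall (s : S) (delta : formula), Delta0P delta -> free_below 3 delta ->
    (exists x : M, sat (scons x (scons m0 (fun _ => eM s))) delta) ->
    exists x v : N, [/\ is_V beta v, x \E v
      & sat (scons x (scons n0 (fun _ => eN s))) delta]) ->
  transfers eM eN v (env HM [:: m0]) (env HN [:: n0]).
Proof.
move=> Vv H t [u Qu].
have d : D0 3 (fun M r => exists e, e \E r 0 /\ (is_env1 e (r 1) /\ verifies (r 0) e (r 2))).
  by definability; exact: D0_env1.
have [p [dp fp sp]] := d.
have [|u' [w [Vw u'w /sp /= [e [eu' [/is_env1E -> Qu']]]]]] := H t p dp fp.
  exists u; apply/sp; exists (env HM [:: m0]) => /=; have [eu _] := verifies_in Qu.
  by split=> //; split=> //; exact/is_env1E.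
by exists u'; rewrite (is_V_uniq HN Vv Vw).
Qed.

End Equivalence.

Unset Implicit Arguments.

Theorem theorem7p2 (M N S : structure) (eM : S -> M) (eN : S -> N)
    (M_KPP : KPP M) (M_Sigma1P_separation : Separation (SigmaP 1) M)
    (N_KPP : KPP N)
    (M_countable : countable [set: M]) (N_countable : countable [set: N])
    (M_nonstandard : nonstandard M) (N_nonstandard : nonstandard N)
    (S_cut_M : rank_cut eM) (S_cut_N : rank_cut eN)
    (m0 : M) (n0 beta : N) (beta_ord : ordinal_in beta) :
  [<-> exists i : M -> N, rank_initial_over eM eN m0 n0 beta i ;
       SSy eM = SSy eN /\
       (forall (s : S) (delta : formula),
          Delta0P delta -> free_below 3 delta ->
          (exists x : M,
             sat (scons x (scons m0 (fun _ => eM s))) delta) ->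
          exists x v : N, [/\ is_V beta v, x \E v
            & sat (scons x (scons n0 (fun _ => eN s))) delta]) ;
       exists I : (nat -> bool) -> M -> N,
         (forall g, rank_initial_over eM eN m0 n0 beta (I g)) /\
         (forall g g', lt_lex g g' -> lt_rank (I g) (I g')) ;
       exists i : M -> N,
         rank_initial_over eM eN m0 n0 beta i /\ topless i ].
Proof.
have [v Vv] := V_total N_KPP beta_ord; have tv := V_transitive N_KPP Vv.
tfae.
- move=> [i iP]; split; last by move=> s delta dd _; exact: embedding_sigma iP dd.
  by rewrite /SSy (embedding_same_codes M_KPP N_KPP S_cut_M iP).
- move=> [/(congr1 snd) /= same_codes sigma].
  have T := transfers_of_sigma (HM := M_KPP) N_KPP Vv sigma.
  have [i [ri fi im iv]] := embedding_of_transfers M_Sigma1P_separation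
    S_cut_M S_cut_N same_codes M_countable N_countable tv T.
  have [I [IP Ilt]] := embedding_tree M_KPP N_KPP M_Sigma1P_separation
    S_cut_M S_cut_N same_codes M_countable N_countable tv (And4 ri fi im iv).
  exists I; split=> [g|g g' /Ilt [c [cI' _ Ic]]].
    have [rI fI Im Iv] := IP g; split=> // _ [x _ <-].
    exact/(rank_belowE N_KPP _ Vv).
  have [rI _ _ _] := IP g; have [rI' _ _ _] := IP g'.
  exact: (lt_rank_of_bound M_KPP N_KPP rI rI' cI' Ic).
- move=> [I [IP Ilt]]; apply: contrapT => nI.
  have least g : exists b : N, [/\ ordinal_in b, ~ range (I g) b
      & ~ exists b', [/\ ordinal_in b', ~ range (I g) b' & b' \E b]].
    apply: contrapT => H; apply: nI; exists (I g); split=> //.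
    have [_ _ _ Ib] := IP g; split; first by exists beta.
    by move=> b ob nb; apply: contrapT => nb'; apply: H; exists b.
  have [f fP] := choice least.
  have sep_f g g' : lt_lex g g' -> f g <> f g'.
    move=> /Ilt [lt _] E; have [_ _ H] := fP g; have [ob nb _] := fP g'.
    have [rI _ _ _] := IP g; have [rI' _ _ _] := IP g'.
    apply: H; rewrite E; exact: (smaller_ordinal_outside N_KPP rI rI' lt ob nb).
  apply: (uncountable_cantor (f := f)) N_countable => g g' E.
  by apply: contrapT => /lt_lex_total[/sep_f|/sep_f]; rewrite E; apply.
- by move=> [i [iP _]]; exists i.
Qed.
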